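(* Let $n\ge 4$. For $\gamma\in(0,\pi)$ let $h^0_{1,n/2}:\mathbb{B}^n\to(-1,1)$ be the harmonic function $$h^0_{1,n/2}(x)=\int_{\mathbb{S}^{n-1}}\frac{1-|x|^2}{|x-y|^{n}}\Big(\mathbf{1}_{S(e_n,\gamma)}(y)-\mathbf{1}_{\mathbb{S}^{n-1}\setminus S(e_n,\gamma)}(y)\Big)\,d\sigma^0(y),\qquad x\in\mathbb{B}^n .$$ Then, for a suitable $\gamma\in(0,\pi)$, the function $u=h^0_{1,n/2}$ is a counterexample to the conjecture that every harmonic function $u:\mathbb{B}^n\to(-1,1)$ satisfies $$|\nabla u(x)|\le 2\,\frac{\omega_{n-1}}{\omega_n}\,\frac{1-u^2(x)}{1-|x|^2}\qquad\text{for all } |x|<1;$$ that is, there are $\gamma\in(0,\pi)$ and $x\in\mathbb{B}^n$ such that the function $u=h^0_{1,n/2}$ associated with $\gamma$ satisfies $$|\nabla u(x)|> 2\,\frac{\omega_{n-1}}{\omega_n}\,\frac{1-u^2(x)}{1-|x|^2}.$$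
   Context: $\mathbb{B}^n$ is the open unit ball of $\mathbb{R}^n$, $\mathbb{S}^{n-1}$ the unit sphere, $|\cdot|$ the Euclidean norm. $\omega_k$ is the $k$-dimensional volume of the unit ball of $\mathbb{R}^k$. $\sigma^0$ is the rotation invariant Borel measure on $\mathbb{S}^{n-1}$ normalized by $\sigma^0(\mathbb{S}^{n-1})=1$. $e_n=(0,\ldots,0,1)$ is the north pole, and for $\gamma\in[0,\pi]$, $S(e_n,\gamma)=\{y\in\mathbb{S}^{n-1}:\langle e_n,y\rangle>\cos\gamma\}$ is the hyperspherical cap with center $e_n$ and contact angle $\gamma$. *)

(* Defs.v *)
From mathcomp Require Import all_boot all_order all_algebra.
From mathcomp Require Import all_classical all_reals all_analysis.
Import Order.TTheory GRing.Theory Num.Theory.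
Import numFieldNormedType.Exports.

Set Implicit Arguments.
Unset Strict Implicit.
Unset Printing Implicit Defensive.

Local Open Scope classical_set_scope.
Local Open Scope ring_scope.

Section Euclidean.
Context {R : realType}.

Definition dotv n (x y : 'rV[R]_n) : R := \sum_(i < n) x 0 i * y 0 i.

(* The norm [`|x|] of the library on ['rV[R]_n] is the sup norm; it induces the
   usual topology, but Euclidean lengths have to be written with [enorm]. *)
Definition enorm n (x : 'rV[R]_n) : R := Num.sqrt (dotv x x).

Definition uball n : set 'rV[R]_n := [set x | enorm x < 1].

Definition usphere n : set 'rV[R]_n := [set x | enorm x = 1].

Definition north n : 'rV[R]_n := \row_(j < n) (j.+1 == n)%:R.

Definition cap n (gamma : R) : set 'rV[R]_n :=
  [set y | usphere y /\ cos gamma < dotv (north n) y].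

End Euclidean.

Section Volume.
Context {R : realType}.

(* Lebesgue measure on R^k as the iterated product of the one-dimensional
   Lebesgue measure; at each step the measure of A is the integral of the
   measures of its sections, as in the library's [product_measure1]. *)
Fixpoint lebesgue_rV (k : nat) : set 'rV[R]_k -> \bar R :=
  match k return set 'rV[R]_k -> \bar R with
  | 0 => fun A => (\1_A (0 : 'rV[R]_0))%:E
  | k'.+1 => fun A =>
      (\int[@lebesgue_measure R]_t
         lebesgue_rV [set v : 'rV[R]_k' | A (row_mx (t%:M : 'rV[R]_1) v)])%E
  end.

Definition omega (k : nat) : R := fine (lebesgue_rV (@uball R k)).

End Volume.

Definition borel_rV (R : realType) (n : nat) :=
  g_sigma_algebraType (@open 'rV[R]_n).

Section SphereMeasure.
Context {R : realType}.

Definition rotation n (Q : 'M[R]_n) : Prop :=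
  Q *m Q^T = 1%:M /\ \det Q = 1.

(* A Borel measure on the sphere is represented by a Borel measure on R^n
   giving no mass to the complement of the sphere.  For 2 <= n exactly one
   measure satisfies this predicate. *)
Definition normalized_sphere_measure n
    (sigma : {measure set (borel_rV R n) -> \bar R}) : Prop :=
  [/\ sigma (@usphere R n) = 1%E,
      sigma (~` @usphere R n) = 0%E &
      forall (Q : 'M[R]_n) (A : set (borel_rV R n)),
        rotation Q -> measurable A ->
        sigma [set y *m Q | y in (A : set 'rV[R]_n)] = sigma A].

End SphereMeasure.

Section Differential.
Context {R : realType} {n : nat}.
Implicit Types (f : 'rV[R]_n -> R) (U : set 'rV[R]_n).

Definition partial (i : 'I_n) f : 'rV[R]_n -> R :=
  fun x => 'D_(delta_mx 0 i) f x.

Definition grad f (x : 'rV[R]_n) : 'rV[R]_n := \row_i partial i f x.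

(* [partial] is total, so the existence of the derivatives is required
   separately.  On an open set, continuity of all second partial derivatives
   entails that f is of class C^2. *)
Definition C2_on U f : Prop := forall x, U x ->
  forall i j : 'I_n,
    [/\ derivable f x (delta_mx 0 i),
        derivable (partial i f) x (delta_mx 0 j) &
        {for x, continuous (partial j (partial i f))}].

Definition laplacian f (x : 'rV[R]_n) : R :=
  \sum_(i < n) partial i (partial i f) x.

Definition harmonic_on U f : Prop :=
  C2_on U f /\ forall x, U x -> laplacian f x = 0.

End Differential.

(* The values for x outside the unit ball are irrelevant. *)
Definition h0 (R : realType) (n : nat)
    (sigma : {measure set (borel_rV R n) -> \bar R}) (gamma : R)
    (x : 'rV[R]_n) : R :=
  (\int[sigma]_(y in @usphere R n)
     ((1 - enorm x ^+ 2) / enorm (x - y) ^+ n *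
      (\1_(cap gamma) y - \1_(@usphere R n `\` cap gamma) y)))%R.

(* Main.v *)
Require Import Defs.
From mathcomp Require Import all_boot all_order all_algebra.
From mathcomp Require Import all_classical all_reals all_analysis.
From mathcomp Require Import measurable_realfun ring lra.
Import Order.TTheory GRing.Theory Num.Theory.
Import numFieldNormedType.Exports.

(** Place the point at the centre of the ball and let the cap be a little
    smaller than a half-sphere: [gamma] is the angle with cosine [s], for a small
    [s > 0].  Let [T] be the last coordinate of a random point of the sphere, and
    put [M = E |T|], [D = P(|T| <= s)], [X = E(|T|; |T| <= s)] and
    [K = omega_(n-1) / omega_n].  Since the law of [T] is symmetric, [u 0 = - D]
    ([mean_zsign]), and the derivative of [u] at [0] along the axis is
    [n (M - X)] ([mean_entry_zsign]).  What has to be shown is therefore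
    [n (M - X) > 2 K (1 - D^2)].

    For [s = 0] this reads [n M > 2 K], and in fact [n M >= 2 K]
    ([abs_moment_ge]): the half-sphere is a borderline case of the conjecture.
    As [s] grows from [0], the loss [n X] and the gain [2 K D^2] are both of
    second order in [s], and the gain is the larger one exactly when
    [n^2 < 8 (n - 1) K^2].  By [omega_ratio] the number [1 / K] is the integral
    of [(1 - t^2)^((n-1)/2)] over [[-1, 1]], and [wallis_lt] gives the inequality
    for every [n >= 4]; for [n = 3] the two sides agree.  [gradient_inequality]
    does this comparison for an explicit [s] instead of a limit.

    Besides its total mass, only the rotation invariance of the measure is used.  It
    enters through one integration by parts, Stein's identity [stein]:
    differentiating the constant integrals of a function composed with the
    rotations of a coordinate plane, and summing over the planes, shows that
    the spherical Laplacian of a function of [<x, y>] has mean zero.  Three test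
    functions are inserted in it.  The derivative of the Poisson kernel along the
    sphere gives that the Poisson kernel has mean [1] ([poisson_total]), hence
    [|u| < 1] ([poisson_integral_lt1]).  The bounded solution of the equation
    [(1 - t^2) phi' - (n - 1) t phi = 1 - C |t|] gives the lower bound of [M]
    ([stein_solution], [abs_moment_ge]).  The primitive of a tent function gives
    a lower bound of [D] in terms of [X] ([zone_mass_ge]).

    Harmonicity ([harmonic_poisson_integral]) is the harmonicity of the Poisson
    kernel.  The derivatives pass under the integral because the sphere is
    compact: difference quotients of a kernel with jointly continuous derivative
    converge uniformly on it ([near_usphere_uniform], [is_derive_mean]). *)

Set Implicit Arguments.
Unset Strict Implicit.
Unset Printing Implicit Defensive.

Local Open Scope classical_set_scope.
Local Open Scope ring_scope.

(** * Euclidean geometry in row vectors *)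

Section Dot.
Context {R : realType} {n : nat}.
Implicit Types x y z : 'rV[R]_n.

Lemma dotvC x y : dotv x y = dotv y x.
Proof. by apply: eq_bigr => i _; rewrite mulrC. Qed.

Lemma dotvDl x y z : dotv (x + y) z = dotv x z + dotv y z.
Proof.
by rewrite -big_split/=; apply: eq_bigr => i _; rewrite mxE mulrDl.
Qed.

Lemma dotvZl (a : R) x y : dotv (a *: x) y = a * dotv x y.
Proof. by rewrite mulr_sumr; apply: eq_bigr => i _; rewrite mxE mulrA. Qed.

Lemma dotvDr x y z : dotv x (y + z) = dotv x y + dotv x z.
Proof. by rewrite dotvC dotvDl !(dotvC x). Qed.

Lemma dotvZr (a : R) x y : dotv x (a *: y) = a * dotv x y.
Proof. by rewrite dotvC dotvZl dotvC. Qed.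

Lemma dotvNl x y : dotv (- x) y = - dotv x y.
Proof. by rewrite -scaleN1r dotvZl mulN1r. Qed.

Lemma dotvNr x y : dotv x (- y) = - dotv x y.
Proof. by rewrite dotvC dotvNl dotvC. Qed.

Lemma dotv0l x : dotv 0 x = 0.
Proof. by rewrite -(scale0r 0) dotvZl mul0r. Qed.

Lemma dotv_delta i x : dotv x (delta_mx 0 i) = x 0 i.
Proof.
rewrite /dotv (bigD1 i)//= mxE !eqxx mulr1 big1 ?addr0// => j ji.
by rewrite mxE (negbTE ji) andbF mulr0.
Qed.

Lemma dotvv_ge0 x : 0 <= dotv x x.
Proof. by apply: sumr_ge0 => i _; rewrite -expr2 sqr_ge0. Qed.

Lemma sqr_enorm x : enorm x ^+ 2 = dotv x x.
Proof. by rewrite sqr_sqrtr// dotvv_ge0. Qed.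

Lemma enorm_ge0 x : 0 <= enorm x.
Proof. exact: sqrtr_ge0. Qed.

Lemma enorm0 : enorm (0 : 'rV[R]_n) = 0.
Proof. by rewrite /enorm dotv0l sqrtr0. Qed.

Lemma usphereP x : usphere x <-> dotv x x = 1.
Proof.
rewrite /usphere /=; split => [h|h]; first by rewrite -sqr_enorm h expr1n.
by rewrite /enorm h sqrtr1.
Qed.

Lemma uballP x : uball x <-> dotv x x < 1.
Proof.
rewrite /uball /=; split => [h|h].
  by rewrite -sqr_enorm expr_lt1// enorm_ge0.
by rewrite -(@expr_lt1 _ 2)// ?enorm_ge0// sqr_enorm.
Qed.

(** The double sum counts every coordinate plane twice. *)
Lemma lagrange_identity x y : dotv x x * dotv y y - dotv x y ^+ 2 =
  2^-1 * \sum_i \sum_j (x 0 j * y 0 i - x 0 i * y 0 j) ^+ 2.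
Proof.
have -> : \sum_i \sum_j (x 0 j * y 0 i - x 0 i * y 0 j) ^+ 2 =
   \sum_i \sum_j ((x 0 j * x 0 j) * (y 0 i * y 0 i)) +
   \sum_i \sum_j ((x 0 i * x 0 i) * (y 0 j * y 0 j)) -
   2 * \sum_i \sum_j ((x 0 i * y 0 i) * (x 0 j * y 0 j)).
  rewrite -big_split/= mulr_sumr -sumrB; apply: eq_bigr => i _.
  rewrite -big_split/= mulr_sumr -sumrB; apply: eq_bigr => j _.
  by ring.
have bigE (f g : 'I_n -> R) :
    \sum_i \sum_j (f i * g j) = (\sum_i f i) * (\sum_j g j).
  by rewrite mulr_suml; apply: eq_bigr => i _; rewrite mulr_sumr.
rewrite exchange_big/= !bigE /dotv; by field.
Qed.

Lemma cauchy_schwarz x y : dotv x y ^+ 2 <= dotv x x * dotv y y.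
Proof.
rewrite -subr_ge0 lagrange_identity mulr_ge0//.
by apply: sumr_ge0 => i _; apply: sumr_ge0 => j _; rewrite sqr_ge0.
Qed.

Lemma ler_dotv x y : usphere y -> `|dotv x y| <= enorm x.
Proof.
move=> /usphereP y1; rewrite -(@ler_pXn2r _ 2)// ?nnegrE ?normr_ge0 ?enorm_ge0//.
by rewrite sqr_enorm -normrX ger0_norm ?sqr_ge0// (le_trans (cauchy_schwarz _ _))// y1 mulr1.
Qed.

Lemma dotv_sub x y : dotv (x - y) (x - y) = dotv x x - 2 * dotv x y + dotv y y.
Proof. by rewrite !(dotvDl, dotvDr, dotvNl, dotvNr) (dotvC y x); ring. Qed.

(** By the Cauchy-Schwarz inequality the squared distance is at least
    [(1 - |x|)^2]. *)
Lemma dist_sphere_gt0 x y : uball x -> usphere y -> 0 < dotv (x - y) (x - y).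
Proof.
move=> x1 y1; rewrite dotv_sub.
have := ler_dotv x y1; rewrite -sqr_enorm.
move: x1 y1; rewrite /uball /= => x1 /usphereP ->.
have := enorm_ge0 x; move: (enorm x) (dotv x y) x1 => a b a1 a0.
rewrite ler_norml => /andP[_ ba].
have : 0 < (1 - a) ^+ 2 by rewrite exprn_gt0// subr_gt0.
nra.
Qed.

End Dot.

Section Continuity.
Context {R : realType} {n : nat}.

Lemma continuous_entry (i : 'I_n) : continuous (fun y : 'rV[R]_n => y 0 i).
Proof. exact: coord_continuous. Qed.

Lemma cvg_dotv (T : Type) (F : set_system T) (FF : Filter F)
    (f g : T -> 'rV[R]_n) (a b : 'rV[R]_n) :
  f @ F --> a -> g @ F --> b -> (fun t => dotv (f t) (g t)) @ F --> dotv a b.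
Proof.
move=> fa gb; apply: cvg_big; [exact: add_continuous|move=> i _; apply: cvgM].
  exact: (cvg_comp _ _ fa (@continuous_entry i a)).
exact: (cvg_comp _ _ gb (@continuous_entry i b)).
Qed.

Lemma cvg_enorm (T : Type) (F : set_system T) (FF : Filter F)
    (f : T -> 'rV[R]_n) (a : 'rV[R]_n) :
  f @ F --> a -> (fun t => enorm (f t)) @ F --> enorm a.
Proof.
by move=> fa; apply: (cvg_comp _ _ (cvg_dotv FF fa fa)); exact: sqrt_continuous.
Qed.

Lemma enorm_continuous : continuous (@enorm R n).
Proof. by move=> x; exact: (cvg_enorm (nbhs_filter x) cvg_id). Qed.

Lemma dotv_continuous (x : 'rV[R]_n) : continuous (dotv x).
Proof. by move=> y; exact: (cvg_dotv (nbhs_filter y) (cvg_cst x) cvg_id). Qed.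

Lemma open_uball : open (@uball R n).
Proof.
rewrite (_ : @uball R n = @enorm R n @^-1` [set r | r < 1])//.
by apply: open_comp => [x _|]; [exact: enorm_continuous|exact: open_lt].
Qed.

Lemma closed_usphere : closed (@usphere R n).
Proof.
rewrite (_ : @usphere R n = @enorm R n @^-1` [set 1])//.
by apply: closed_comp => [x _|]; [exact: enorm_continuous|exact: closed_eq].
Qed.

Lemma compact_usphere : compact (@usphere R n).
Proof.
apply: bounded_closed_compact closed_usphere.
exists 1; split => // M M1 y /usphereP y1.
rewrite /= [leLHS]/Num.norm/= mx_normrE.
apply: bigmax_le; first by rewrite (le_trans ler01)// ltW.
move=> [i j] _ /=; rewrite (le_trans _ (ltW M1))//.
rewrite -(@expr_le1 _ 2)// -normrX ger0_norm ?sqr_ge0// -y1 /dotv.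
rewrite (bigD1 j)//= (ord1 i) -expr2 lerDl.
by apply: sumr_ge0 => k _; rewrite -expr2 sqr_ge0.
Qed.

End Continuity.

(** * Calculus of functions given by formulas *)

Section RealDerivative.
Context {R : realType}.
Implicit Types (f g : R -> R) (x a b c : R).

Lemma der_eq f x a b : is_derive x 1 f a -> a = b -> is_derive x 1 f b.
Proof. by move=> ? <-. Qed.

Lemma der_cst c x : is_derive x 1 (fun=> c) 0.
Proof. exact: is_derive_cst. Qed.

Lemma der_id x : is_derive x 1 (fun t : R => t) 1.
Proof. exact: is_derive_id. Qed.

Lemma derD f g x a b : is_derive x 1 f a -> is_derive x 1 g b ->
  is_derive x 1 (fun t => f t + g t) (a + b).
Proof. exact: is_deriveD. Qed.

Lemma derN f x a : is_derive x 1 f a -> is_derive x 1 (fun t => - f t) (- a).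
Proof. exact: is_deriveN. Qed.

Lemma derB f g x a b : is_derive x 1 f a -> is_derive x 1 g b ->
  is_derive x 1 (fun t => f t - g t) (a - b).
Proof. exact: is_deriveB. Qed.

Lemma derM f g x a b : is_derive x 1 f a -> is_derive x 1 g b ->
  is_derive x 1 (fun t => f t * g t) (a * g x + f x * b).
Proof.
move=> fa gb; apply: der_eq (is_deriveM fa gb) _.
by rewrite /GRing.scale/= addrC (mulrC a).
Qed.

Lemma derZ f c x a : is_derive x 1 f a ->
  is_derive x 1 (fun t => c * f t) (c * a).
Proof. exact: is_deriveZ. Qed.

Lemma der_comp f g x a b : is_derive (g x) 1 f a -> is_derive x 1 g b ->
  is_derive x 1 (fun t => f (g t)) (a * b).
Proof. exact: is_derive1_comp. Qed.

Lemma derX f k x a : is_derive x 1 f a ->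
  is_derive x 1 (fun t => f t ^+ k) (k%:R * f x ^+ k.-1 * a).
Proof.
move=> fa.
suff d : is_derive (f x) 1 (fun u : R => u ^+ k) (k%:R * f x ^+ k.-1).
  exact: der_comp d fa.
apply: DeriveDef; first exact: exprn_derivable.
by rewrite exp_derive /GRing.scale/= mulr1.
Qed.

Lemma derV f x a : f x != 0 -> is_derive x 1 f a ->
  is_derive x 1 (fun t => (f t)^-1) (- a / f x ^+ 2).
Proof.
move=> fx fa; apply: der_eq (is_deriveV fx fa) _.
by rewrite /GRing.scale/= !mulNr mulrC.
Qed.

Lemma der_sqrt f x a : is_derive x 1 f a -> 0 < f x ->
  is_derive x 1 (fun t => Num.sqrt (f t)) (a / (2 * Num.sqrt (f x))).
Proof.
move=> fa f0; apply: der_eq (der_comp (is_derive1_sqrt f0) fa) _.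
by rewrite mulrC.
Qed.

(** Both the Poisson kernel and the weight [(1 - t^2)^(k/2)] are powers of a
    square root, and their derivatives stay in that family. *)
Lemma der_sqrtXN f m x a : is_derive x 1 f a -> 0 < f x ->
  is_derive x 1 (fun t => Num.sqrt (f t) ^- m)
    (- m%:R / 2 * a * Num.sqrt (f x) ^- m.+2).
Proof.
move=> fa f0.
have r0 : Num.sqrt (f x) != 0 by rewrite gt_eqF// sqrtr_gt0.
apply: der_eq.
  apply: derV; last by apply: derX; exact: der_sqrt.
  by rewrite expf_neq0.
case: m => [|m]; first by rewrite !mul0r oppr0 !mul0r.
by rewrite /= !exprS; field; rewrite r0 expf_neq0.
Qed.

Lemma der_continuous f x a : is_derive x 1 f a -> {for x, continuous f}.
Proof.
by case=> /derivable1_diffP fx _; exact: differentiable_continuous.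
Qed.

End RealDerivative.

Section PointwiseContinuity.
Context {R : realType} {X : topologicalType}.
Implicit Types (f g : X -> R) (p : X).

Lemma cont_cst (c : R) p : {for p, continuous (fun=> c)}.
Proof. exact: cst_continuous. Qed.

Lemma contD f g p : {for p, continuous f} -> {for p, continuous g} ->
  {for p, continuous (fun q => f q + g q)}.
Proof. by move=> cf cg; exact: (cvgD cf cg). Qed.

Lemma contN f p : {for p, continuous f} -> {for p, continuous (fun q => - f q)}.
Proof. by move=> cf; exact: (cvgN cf). Qed.

Lemma contB f g p : {for p, continuous f} -> {for p, continuous g} ->
  {for p, continuous (fun q => f q - g q)}.
Proof. by move=> cf cg; exact: (cvgB cf cg). Qed.

Lemma contM f g p : {for p, continuous f} -> {for p, continuous g} ->
  {for p, continuous (fun q => f q * g q)}.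
Proof. by move=> cf cg; exact: (cvgM cf cg). Qed.

Lemma contX f k p : {for p, continuous f} ->
  {for p, continuous (fun q => f q ^+ k)}.
Proof.
move=> cf; elim: k => [|k IH]; first exact: cont_cst.
have -> : (fun q => f q ^+ k.+1) = (fun q => f q * f q ^+ k).
  by apply/funext => q; rewrite exprS.
exact: contM.
Qed.

Lemma contV f p : f p != 0 -> {for p, continuous f} ->
  {for p, continuous (fun q => (f q)^-1)}.
Proof. by move=> f0 cf; exact: (cvgV f0 cf). Qed.

Lemma cont_comp (h : R -> R) f p : {for f p, continuous h} ->
  {for p, continuous f} -> {for p, continuous (fun q => h (f q))}.
Proof. by move=> ch cf; exact: (continuous_comp cf ch). Qed.

End PointwiseContinuity.

(** Reduces the continuity of a polynomial expression to that of its atoms,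
    which [leaf] has to treat. *)
Ltac cont_arith leaf := lazymatch goal with
  | |- prop_for _ (inPhantom (continuous (fun q => @?f q + @?g q))) =>
      apply: (@contD _ _ f g); cont_arith leaf
  | |- prop_for _ (inPhantom (continuous (fun q => - @?f q))) =>
      apply: (@contN _ _ f); cont_arith leaf
  | |- prop_for _ (inPhantom (continuous (fun q => @?f q * @?g q))) =>
      apply: (@contM _ _ f g); cont_arith leaf
  | |- prop_for _ (inPhantom (continuous (fun q => @?f q ^+ _))) =>
      apply: (@contX _ _ f); cont_arith leaf
  | |- _ => leaf
  end.

Section VectorContinuity.
Context {R : realType} {n : nat} {X : topologicalType}.
Implicit Types (f g : X -> 'rV[R]_n) (p : X).

Lemma cont_entry f i p : {for p, continuous f} ->
  {for p, continuous (fun q => f q 0 i)}.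
Proof. by move=> cf; exact: (continuous_comp cf (@continuous_entry R n i _)). Qed.

Lemma cont_dotv f g p : {for p, continuous f} -> {for p, continuous g} ->
  {for p, continuous (fun q => dotv (f q) (g q))}.
Proof. by move=> cf cg; exact: (cvg_dotv (nbhs_filter p) cf cg). Qed.

End VectorContinuity.

(** * Means over the sphere *)

Section SphereIntegral.
Context {R : realType} {n : nat}.
Context (sigma : {measure set (borel_rV R n) -> \bar R}).
Context (sigmaP : normalized_sphere_measure sigma).
Implicit Types f g : 'rV[R]_n -> R.

Notation S := (@usphere R n).
Notation E f := (Rintegral sigma (S : set (borel_rV R n)) f).

Lemma measurable_open_rV (U : set 'rV[R]_n) :
  open U -> measurable (U : set (borel_rV R n)).
Proof. by move=> oU; exact: sub_sigma_algebra. Qed.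

Lemma measurable_usphere : measurable (S : set (borel_rV R n)).
Proof.
rewrite -(setCK S); apply: measurableC; apply: measurable_open_rV.
exact: closed_openC closed_usphere.
Qed.
Hint Resolve measurable_usphere : core.

(** On [D] the preimage of an open set coincides with its interior, so that
    continuity is needed at the points of [D] only. *)
Lemma measurable_fun_continuous_at (D : set (borel_rV R n)) f :
  measurable D -> (forall y, D y -> {for y, continuous f}) ->
  measurable_fun D (f : borel_rV R n -> R).
Proof.
move=> mD cf.
apply: (measurability _ (RGenOpens.measurableE R)).
move=> _ [_ [a [b ->] <-]]; set U := [set` _].
have oU : open U by exact: interval_open.
rewrite (_ : D `&` f @^-1` U = D `&` interior (f @^-1` U : set 'rV[R]_n)).
  by apply: measurableI => //; apply: measurable_open_rV; exact: open_interior.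
apply/seteqP; split => [y [Dy Uy]|y [Dy]]; split=> //.
  by apply: (cf y Dy); exact: open_nbhs_nbhs.
exact: interior_subset.
Qed.

(** On a probability space this is a class of integrable functions that is
    stable under products. *)
Definition bounded_measurable f :=
  measurable_fun (S : set (borel_rV R n)) (f : borel_rV R n -> R) /\
  exists M, forall y, S y -> `|f y| <= M.

(** Boundedness comes from the compactness of the sphere. *)
Lemma bounded_measurable_continuous f :
  (forall y, S y -> {for y, continuous f}) -> bounded_measurable f.
Proof.
move=> cf; split; first exact: measurable_fun_continuous_at.
have cfS : {within S, continuous f}.
  apply: continuous_in_subspaceT => y /[!inE]; exact: cf.
have := continuous_compact cfS compact_usphere.
move=> /compact_bounded [M [Mr MP]].
exists (M + 1) => y Sy; apply: (MP (M + 1)); first by rewrite ltrDl.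
by exists y.
Qed.

Lemma bounded_measurableD f g :
  bounded_measurable f -> bounded_measurable g -> bounded_measurable (f \+ g).
Proof.
move=> [mf [M fM]] [mg [N gN]]; split; first exact: measurable_funD.
exists (M + N) => y Sy; rewrite (le_trans (ler_normD _ _))// lerD ?fM ?gN//.
Qed.

Lemma bounded_measurableM f g :
  bounded_measurable f -> bounded_measurable g -> bounded_measurable (f \* g).
Proof.
move=> [mf [M fM]] [mg [N gN]]; split; first exact: measurable_funM.
by exists (M * N) => y Sy; rewrite normrM ler_pM ?fM ?gN.
Qed.

Lemma bounded_measurable_cst (c : R) : bounded_measurable (fun=> c).
Proof. by apply: bounded_measurable_continuous => y _; apply: (@cst_continuous _ _ c). Qed.

Lemma bounded_measurableN f :
  bounded_measurable f -> bounded_measurable (fun y => - f y).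
Proof.
move=> [mf [M fM]]; split; first exact: measurable_funN.
by exists M => y Sy; rewrite normrN fM.
Qed.

Lemma bounded_measurable_sum (I : Type) (r : seq I) (P : pred I)
    (f : I -> 'rV[R]_n -> R) :
  (forall i, bounded_measurable (f i)) ->
  bounded_measurable (fun y => \sum_(i <- r | P i) f i y).
Proof.
move=> bf; elim: r => [|i r IH].
  by under eq_fun do rewrite big_nil; exact: bounded_measurable_cst.
under eq_fun do rewrite big_cons.
by case: (P i) => //; exact: bounded_measurableD.
Qed.

Lemma bounded_measurable_indic (A : set (borel_rV R n)) :
  measurable A -> bounded_measurable (\1_A : 'rV[R]_n -> R).
Proof.
move=> mA; split; first exact: measurable_indic.
by exists 1 => y _; rewrite indicE; case: (_ \in _); rewrite ?normr1// normr0.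
Qed.

Lemma integrable_sphere f : bounded_measurable f ->
  sigma.-integrable (S : set (borel_rV R n)) (EFin \o (f : borel_rV R n -> R)).
Proof.
case: sigmaP => s1 _ _ [mf [M fM]].
apply: measurable_bounded_integrable => //.
- by rewrite s1 ltry.
- exists M; split=> [|x Mx y Sy]; first by rewrite num_real.
  by rewrite /= (le_trans (fM _ Sy))// ltW.
Qed.

Lemma eq_mean f g : (forall y, S y -> f y = g y) -> E f = E g.
Proof. by move=> fg; apply: eq_Rintegral => y /[!inE]; exact: fg. Qed.

Lemma meanD f g : bounded_measurable f -> bounded_measurable g ->
  E (fun y => f y + g y) = E f + E g.
Proof. by move=> bf bg; apply: RintegralD => //; exact: integrable_sphere. Qed.

Lemma meanB f g : bounded_measurable f -> bounded_measurable g ->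
  E (fun y => f y - g y) = E f - E g.
Proof. by move=> bf bg; apply: RintegralB => //; exact: integrable_sphere. Qed.

Lemma meanZ (c : R) f : bounded_measurable f ->
  E (fun y => c * f y) = c * E f.
Proof. by move=> bf; apply: RintegralZl => //; exact: integrable_sphere. Qed.

Lemma mean_cst (c : R) : E (fun=> c) = c.
Proof.
by case: sigmaP => s1 _ _; rewrite Rintegral_cst// s1 mulr1.
Qed.

Lemma mean_sum (I : Type) (r : seq I) (P : pred I) (f : I -> 'rV[R]_n -> R) :
  (forall i, bounded_measurable (f i)) ->
  E (fun y => \sum_(i <- r | P i) f i y) = \sum_(i <- r | P i) E (f i).
Proof.
move=> bf; elim: r => [|i r IH].
  by rewrite big_nil -[RHS](mean_cst 0); apply: eq_mean => y _; rewrite big_nil.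
rewrite big_cons; case: ifPn => Pi.
  rewrite -IH -meanD//; last exact: bounded_measurable_sum.
  by apply: eq_mean => y _; rewrite big_cons Pi.
by rewrite -IH; apply: eq_mean => y _; rewrite big_cons (negbTE Pi).
Qed.

Lemma le_mean f g : bounded_measurable f -> bounded_measurable g ->
  (forall y, S y -> f y <= g y) -> E f <= E g.
Proof. by move=> bf bg fg; apply: le_Rintegral => //; exact: integrable_sphere. Qed.

Lemma norm_mean_le f (M : R) : bounded_measurable f ->
  (forall y, S y -> `|f y| <= M) -> `|E f| <= M.
Proof.
move=> bf fM; rewrite ler_norml -{1}(mean_cst (- M)) -{2}(mean_cst M).
have bc c := bounded_measurable_cst c.
by apply/andP; split; apply: le_mean => // y /fM; rewrite ler_norml => /andP[].
Qed.

(** If the mean vanished, [f * g] and hence [g] would vanish almost everywhere. *)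
Lemma mean_gt0 f g : bounded_measurable f -> bounded_measurable g ->
  (forall y, S y -> 0 < f y) -> (forall y, S y -> 0 <= g y) ->
  0 < E g -> 0 < E (fun y => f y * g y).
Proof.
move=> bf bg f0 g0 Eg.
have bfg := bounded_measurableM bf bg.
have Efg0 : 0 <= E (fun y => f y * g y).
  by apply: Rintegral_ge0 => y Sy; rewrite mulr_ge0 ?g0// ltW ?f0.
rewrite lt_neqAle Efg0 andbT; apply/eqP => /esym Efg.
suff Eg0 : E g = 0 by rewrite Eg0 ltxx in Eg.
have mfg : measurable_fun (S : set (borel_rV R n))
    (EFin \o (f \* g : borel_rV R n -> R)).
  by apply/measurable_EFinP; case: bfg.
have : (\int[sigma]_(y in S) `|(f y * g y)%:E| = 0)%E.
  have ifg := integrable_fin_num measurable_usphere (integrable_sphere bfg).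
  rewrite -[RHS]/(0%:E) -Efg /Rintegral fineK//.
  apply: eq_integral => y /[!inE] Sy.
  by rewrite /= ger0_norm// mulr_ge0 ?g0// ltW ?f0.
move=> /(ae_eq_integral_abs sigma measurable_usphere mfg) ae0.
rewrite /Rintegral (_ : (\int[sigma]_(y in S) (g y)%:E = 0)%E)//.
have := integral0 sigma (S : set (borel_rV R n)); move=> <-.
apply: ae_eq_integral => //.
  by apply/measurable_EFinP; case: bg.
move: ae0; apply: filterS => y fg0 Sy.
have /= := fg0 Sy => -[] /eqP.
by rewrite mulf_eq0 gt_eqF ?f0//= => /eqP ->.
Qed.

End SphereIntegral.

(** * Continuity and differentiation under the integral sign *)

Section Uniform.
Context {R : realType} {n : nat}.
Notation S := (@usphere R n).

Lemma continuous_slice (X : topologicalType) (G : X -> 'rV[R]_n -> R)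
    (x0 : X) (y : 'rV[R]_n) :
  {for (x0, y), continuous (fun p => G p.1 p.2)} -> {for y, continuous (G x0)}.
Proof.
move=> c.
apply: (@continuous_comp _ _ _ (fun y => (x0, y)) (fun p => G p.1 p.2)) => //.
apply: (@cvg_pair _ _ _ (nbhs y) (nbhs x0) (nbhs y) _ _ _ (cst x0) id).
  exact: cvg_cst.
exact: cvg_id.
Qed.

(** The tube lemma: joint continuity at the points of [{x0} * S] is uniform in
    the second variable because the sphere is compact. *)
Lemma near_usphere_uniform (X : topologicalType) (G : X -> 'rV[R]_n -> R)
    (x0 : X) (e : R) : 0 < e ->
  (forall y, S y -> {for (x0, y), continuous (fun p => G p.1 p.2)}) ->
  \forall x \near x0, forall y, S y -> `|G x y - G x0 y| < e.
Proof.
move=> e0 cG.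
apply: ((compact_near_coveringP S).1 compact_usphere X (nbhs x0)
  (fun x y => `|G x y - G x0 y| < e)) => y Sy.
have e20 : 0 < e / 2 by rewrite divr_gt0.
have /cvgrPdist_lt/(_ _ e20) := cG y Sy.
case=> -[A B] [/= nA nB] AB.
exists (B, A) => // -[y' x] /= [By' Ax].
have h1 := AB (x, y') (conj Ax By').
have h2 := AB (x0, y') (conj (nbhs_singleton nA) By').
move: h1 h2 => /=.
move: (G x y') (G x0 y') (G x0 y) => a b c.
rewrite !ltr_norml => /andP[? ?] /andP[? ?]; lra.
Qed.

End Uniform.

Section ParametricIntegral.
Context {R : realType} {n : nat}.
Context (sigma : {measure set (borel_rV R n) -> \bar R}).
Context (sigmaP : normalized_sphere_measure sigma).

Notation S := (@usphere R n).
Notation E f := (Rintegral sigma (S : set (borel_rV R n)) f).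

Lemma continuous_mean (X : topologicalType) (G : X -> 'rV[R]_n -> R)
    (f : 'rV[R]_n -> R) (x0 : X) :
  bounded_measurable f ->
  (\forall x \near x0, forall y, S y -> {for y, continuous (G x)}) ->
  (forall y, S y -> {for (x0, y), continuous (fun p => G p.1 p.2)}) ->
  {for x0, continuous (fun x => E (fun y => G x y * f y))}.
Proof.
move=> bf cG cG0; have [_ [M fM]] := bf.
apply/cvgrPdist_le => e e0.
have M1 : 0 < `|M| + 1 by rewrite ltr_wpDl.
have eM : 0 < e / (`|M| + 1) by rewrite divr_gt0.
have bG x : (forall y, S y -> {for y, continuous (G x)}) ->
    bounded_measurable (fun y => G x y * f y).
  by move=> ?; apply: bounded_measurableM => //; apply: bounded_measurable_continuous.
have bG0 := bG _ (nbhs_singleton cG).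
near=> x.
have bGx : bounded_measurable (fun y => G x y * f y).
  by apply: bG; near: x.
rewrite -meanB//; apply: (norm_mean_le sigmaP).
  by apply: bounded_measurableD => //; exact: bounded_measurableN.
move=> y Sy; rewrite -mulrBl normrM.
have -> : e = e / (`|M| + 1) * (`|M| + 1) by rewrite divfK// gt_eqF.
rewrite ler_pM// ?(le_trans (fM _ Sy))//; last first.
  by rewrite (le_trans (ler_norm _))// lerDl.
rewrite distrC ltW//; move: y Sy; near: x.
exact: near_usphere_uniform.
Unshelve. all: by end_near. Qed.

(** The mean value theorem for [k t - t * dk t0]. *)
Lemma increment_bound (k dk : R -> R) (t0 d e h : R) :
  (forall t, `|t - t0| < d -> is_derive t 1 k (dk t)) ->
  (forall t, `|t - t0| < d -> `|dk t - dk t0| <= e) ->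
  `|h| < d -> `|k (t0 + h) - k t0 - h * dk t0| <= e * `|h|.
Proof.
move=> kd dke hd.
pose g t := k t - t * dk t0.
have gd t : `|t - t0| < d -> is_derive t 1 g (dk t - dk t0).
  move=> /kd kt.
  apply: der_eq (derB kt (derM (der_id t) (der_cst (dk t0) t))) _.
  by rewrite mul1r mulr0 addr0.
have gab a b : a <= b -> `|a - t0| < d -> `|b - t0| < d ->
    `|g b - g a| <= e * (b - a).
  move=> ab ad bd.
  have near_t t : t \in `[a, b] -> `|t - t0| < d.
    rewrite in_itv/= => /andP[at_ tb]; move: ad bd; rewrite !ltr_norml.
    by move=> /andP[? ?] /andP[? ?]; apply/andP; split; lra.
  have [||c cab ->] := @MVT_segment _ g (fun t => dk t - dk t0) a b ab.
  - by move=> x xab; apply: gd; apply: near_t; exact: subset_itv_oo_cc.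
  - apply: derivable_within_continuous => x xab.
    by case: (gd _ (near_t _ xab)).
  rewrite normrM (ger0_norm (_ : 0 <= b - a)) ?subr_ge0//.
  by rewrite ler_wpM2r ?subr_ge0// dke// near_t.
have -> : k (t0 + h) - k t0 - h * dk t0 = g (t0 + h) - g t0 by rewrite /g; ring.
have d0 : 0 < d by rewrite (le_lt_trans _ hd).
have hE : t0 + h - t0 = h by rewrite addrC addKr.
have [h0|h0] := lerP 0 h.
  rewrite ger0_norm// in hd *.
  by have := gab t0 (t0 + h); rewrite lerDl subrr normr0 hE (ger0_norm h0); apply.
rewrite distrC ltr0_norm// in hd *; have := gab (t0 + h) t0.
by rewrite gerDl subrr normr0 hE -(opprB _ t0) hE (ltr0_norm h0); apply => //; exact: ltW.
Qed.

(** The difference quotients converge uniformly on the sphere, so no dominating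
    function is needed. *)
Lemma is_derive_mean (k dk : R -> 'rV[R]_n -> R) (f : 'rV[R]_n -> R) (t0 : R) :
  bounded_measurable f ->
  (\forall t \near t0, forall y, S y ->
     {for y, continuous (k t)} /\ is_derive t 1 (k^~ y) (dk t y)) ->
  (forall y, S y -> {for (t0, y), continuous (fun p => dk p.1 p.2)}) ->
  is_derive t0 1 (fun t => E (fun y => k t y * f y))
    (E (fun y => dk t0 y * f y)).
Proof.
move=> bf nk cdk; have [_ [M fM]] := bf.
pose I t := E (fun y => k t y * f y).
pose L := E (fun y => dk t0 y * f y); rewrite -/L -/I.
have M1 : 0 < `|M| + 1 by rewrite ltr_wpDl.
have bk t : (forall y, S y ->
     {for y, continuous (k t)} /\ is_derive t 1 (k^~ y) (dk t y)) ->
    bounded_measurable (fun y => k t y * f y).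
  move=> kt; apply: bounded_measurableM => //.
  by apply: bounded_measurable_continuous => // y /kt[].
have bk0 := bk _ (nbhs_singleton nk).
have bdk0 : bounded_measurable (fun y => dk t0 y * f y).
  apply: bounded_measurableM => //; apply: bounded_measurable_continuous => //.
  by move=> y /cdk; exact: continuous_slice.
suff cL : h^-1 *: ((I \o shift t0) (h *: 1) - I t0) @[h --> 0^'] --> L.
  by constructor; [apply/cvg_ex; exists L|exact/cvg_lim].
apply/cvgrPdist_le => e e0.
have eM : 0 < e / (`|M| + 1) by rewrite divr_gt0.
have [d /= d0 dP] : nbhs_ball t0 [set t |
    (forall y, S y ->
       {for y, continuous (k t)} /\ is_derive t 1 (k^~ y) (dk t y)) /\
    (forall y, S y -> `|dk t y - dk t0 y| < e / (`|M| + 1))].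
  by apply/nbhs_ballP; exact: filterI nk (near_usphere_uniform eM cdk).
near=> h.
have h0 : h != 0 by near: h; exact: nbhs_dnbhs_neq.
have hd : `|h| < d.
  near: h; apply: dnbhs0_lt => //.
have bkh : bounded_measurable (fun y => k (t0 + h) y * f y).
  apply: bk; apply: (dP _ _).1.
  by rewrite /ball/= opprD addNKr normrN.
rewrite /= [h%:A]mulr1 (addrC h).
have -> : L - h^-1 *: (I (t0 + h) - I t0) =
    - (h^-1 * (I (t0 + h) - I t0 - h * L)).
  by rewrite [X in _ - X]/(h^-1 * (I (t0 + h) - I t0)) mulrBr mulKf// opprB.
rewrite normrN normrM normfV ler_pdivrMl ?normr_gt0// [leRHS]mulrC.
have bhk : bounded_measurable (fun y => h * (dk t0 y * f y)).
  by apply: bounded_measurableM => //; exact: bounded_measurable_cst.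
have bkk : bounded_measurable (fun y => k (t0 + h) y * f y - k t0 y * f y).
  by apply: bounded_measurableD => //; exact: bounded_measurableN.
have -> : I (t0 + h) - I t0 - h * L =
    E (fun y => k (t0 + h) y * f y - k t0 y * f y - h * (dk t0 y * f y)).
  by rewrite (meanB sigmaP bkk bhk) (meanB sigmaP bkh bk0) (meanZ sigmaP).
apply: (norm_mean_le sigmaP).
  by apply: bounded_measurableD => //; exact: bounded_measurableN.
move=> y Sy.
have -> : k (t0 + h) y * f y - k t0 y * f y - h * (dk t0 y * f y) =
   (k (t0 + h) y - k t0 y - h * dk t0 y) * f y by ring.
have -> : e * `|h| = (e / (`|M| + 1)) * `|h| * (`|M| + 1) by field; rewrite gt_eqF.
rewrite normrM ler_pM// ?(le_trans (fM _ Sy))//; last first.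
  by rewrite (le_trans (ler_norm _))// lerDl.
apply: (@increment_bound (k^~ y) (dk^~ y) t0 d) => //.
  by move=> t td; apply: ((dP t _).1 y Sy).2; rewrite /ball/= distrC.
by move=> t td; apply/ltW/((dP t _).2 y Sy); rewrite /ball/= distrC.
Unshelve. all: by end_near. Qed.

End ParametricIntegral.

(** * Rotations of coordinate planes *)

Section Rotation.
Context {R : realType} {n : nat}.
Implicit Types (i j : 'I_n) (a b : R) (y : 'rV[R]_n).

Definition plane_proj i j : 'M[R]_n := delta_mx i i + delta_mx j j.
Definition plane_turn i j : 'M[R]_n := delta_mx i j - delta_mx j i.

Definition plane_rot i j a : 'M[R]_n :=
  1%:M + (cos a - 1) *: plane_proj i j + sin a *: plane_turn i j.

Lemma plane_rotE i j a y :
  y *m plane_rot i j a =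
  y + (cos a - 1) *: (y 0 i *: delta_mx 0 i + y 0 j *: delta_mx 0 j) +
      sin a *: (y 0 i *: delta_mx 0 j - y 0 j *: delta_mx 0 i).
Proof.
have yE k l : y *m (delta_mx k l : 'M[R]_n) = y 0 k *: delta_mx 0 l.
  rewrite -(mul_delta_mx (0 : 'I_1)) mulmxA.
  rewrite (_ : y *m delta_mx k 0 = (y 0 k)%:M) ?mul_scalar_mx//.
  rewrite [LHS]mx11_scalar; congr (_%:M).
  rewrite mxE (bigD1 k)//= mxE !eqxx mulr1 big1 ?addr0// => l' l'k.
  by rewrite mxE (negbTE l'k) mulr0.
by rewrite /plane_rot !mulmxDr mulmx1 -!scalemxAr !mulmxDr mulmxN !yE.
Qed.

Lemma plane_rotD i j a b : i != j ->
  plane_rot i j (a + b) = plane_rot i j a *m plane_rot i j b.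
Proof.
move=> ij; have ji : j != i by rewrite eq_sym.
have PP : plane_proj i j *m plane_proj i j = plane_proj i j.
  rewrite /plane_proj !(mulmxDl, mulmxDr) !mul_delta_mx.
  by rewrite !mul_delta_mx_0// !(addr0, add0r).
have PJ : plane_proj i j *m plane_turn i j = plane_turn i j.
  rewrite /plane_proj /plane_turn !(mulmxDl, mulmxDr, mulmxN) !mul_delta_mx.
  by rewrite !mul_delta_mx_0// !(oppr0, addr0, add0r).
have JP : plane_turn i j *m plane_proj i j = plane_turn i j.
  rewrite /plane_proj /plane_turn !(mulmxDl, mulmxDr, mulNmx) !mul_delta_mx.
  by rewrite !mul_delta_mx_0// !(oppr0, addr0, add0r) addrC.
have JJ : plane_turn i j *m plane_turn i j = - plane_proj i j.
  rewrite /plane_proj /plane_turn !(mulmxDl, mulmxDr, mulNmx, mulmxN) !mul_delta_mx.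
  by rewrite !mul_delta_mx_0// !(oppr0, opprK, addr0, add0r) opprD addrC.
rewrite /plane_rot !(mulmxDl, mulmxDr, mul1mx, mulmx1) -!scalemxAl -!scalemxAr.
rewrite PP PJ JP JJ cosD sinD.
apply/matrixP => k l; rewrite !mxE.
by ring.
Qed.

Lemma plane_rot0 i j : plane_rot i j 0 = 1%:M.
Proof. by rewrite /plane_rot cos0 sin0 subrr !scale0r !addr0. Qed.

Lemma tr_plane_rot i j a : (plane_rot i j a)^T = plane_rot i j (- a).
Proof.
apply/matrixP => k l; rewrite !mxE cosN sinN (eq_sym l k).
rewrite (andbC (l == i)) (andbC (l == j) (k == j)) (andbC (l == i)) (andbC (l == j)).
by ring.
Qed.

(** The determinant is the square of that of the rotation by half the angle,
    which is [1] or [-1]. *)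
Lemma plane_rotP i j a : i != j -> rotation (plane_rot i j a).
Proof.
move=> ij.
have orth b : plane_rot i j b *m (plane_rot i j b)^T = 1%:M.
  by rewrite tr_plane_rot -plane_rotD// subrr plane_rot0.
split=> //.
have -> : a = a / 2 + a / 2 by field.
rewrite plane_rotD// det_mulmx -{2}det_tr -det_mulmx orth det1 //.
Qed.

Lemma rotation_dotv (Q : 'M[R]_n) y z : rotation Q ->
  dotv (y *m Q) (z *m Q) = dotv y z.
Proof.
move=> [QQ _].
have dotvE (u v : 'rV[R]_n) : dotv u v = (u *m v^T) 0 0.
  by rewrite mxE; apply: eq_bigr => k _; rewrite mxE.
by rewrite !dotvE trmx_mul mulmxA -(mulmxA y) QQ mulmx1.
Qed.

Lemma rotation_tr (Q : 'M[R]_n) : rotation Q -> rotation Q^T.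
Proof.
by move=> [QQ dQ]; split; rewrite ?det_tr// trmxK; exact: mulmx1C.
Qed.

End Rotation.

Lemma cvg_row {R : realType} {n : nat} (T : Type) (F : set_system T)
    (FF : Filter F) (f : T -> 'rV[R]_n) (a : 'rV[R]_n) :
  (forall j, (fun t => f t 0 j) @ F --> a 0 j) -> f @ F --> a.
Proof.
move=> fa A [P nP PA].
have nP0 j : \forall t \near F, P 0 j (f t 0 j) by exact: fa j _ (nP 0 j).
apply: filterS (filter_forall FF nP0) => t Pt; apply: PA => i j.
by rewrite (ord1 i); exact: Pt.
Qed.

Section Invariance.
Context {R : realType} {n : nat}.
Context (sigma : {measure set (borel_rV R n) -> \bar R}).
Context (sigmaP : normalized_sphere_measure sigma).

Notation S := (@usphere R n).
Notation E f := (Rintegral sigma (S : set (borel_rV R n)) f).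

(** The image measure of [sigma] under the rotation agrees with [sigma] on
    measurable sets. *)
Lemma mean_rotation (Q : 'M[R]_n) (f : 'rV[R]_n -> R) :
  rotation Q -> bounded_measurable f -> E (fun y => f (y *m Q)) = E f.
Proof.
move=> rQ bf; have [_ _ inv] := sigmaP.
have rQt := rotation_tr rQ; have [QQ _] := rQ; have QtQ := mulmx1C QQ.
pose phi : borel_rV R n -> borel_rV R n := fun y => (y : 'rV[R]_n) *m Q.
have cphi : continuous (phi : 'rV[R]_n -> 'rV[R]_n).
  move=> y; apply: (cvg_row (nbhs_filter y)) => j; under eq_cvg do rewrite mxE.
  rewrite mxE; apply: cvg_big => [|k _]; first exact: add_continuous.
  by apply: cvgM; [exact: continuous_entry|exact: cvg_cst].
have mphi : measurable_fun [set: borel_rV R n] phi.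
  apply: (@measurability _ _ _ (borel_rV R n) _ phi (@open 'rV[R]_n)) => //.
  move=> _ [U oU <-].
  rewrite setTI; apply: measurable_open_rV.
  by apply: open_comp => // y _; exact: cphi.
have phiS : phi @^-1` S = S.
  by apply/seteqP; split => y; rewrite /preimage /usphere /= /enorm /phi rotation_dotv.
pose g : borel_rV R n -> \bar R := EFin \o ((f : borel_rV R n -> R) \_ S).
have mS := @measurable_usphere R n.
have mg : measurable_fun [set: borel_rV R n] g.
  apply/measurable_EFinP; apply/(measurable_restrictT _ _).1 => //.
  by case: bf.
have bfQ : bounded_measurable (fun y => f (y *m Q)).
  case: bf => mf [M fM]; split; last first.
    by exists M => y Sy; apply: fM; rewrite /usphere /= /enorm rotation_dotv.
  apply: (@measurable_comp _ _ _ _ _ _ (S : set (borel_rV R n)) f _ phi) => //.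
    by move=> _ [y Sy <-]; rewrite -phiS in Sy.
  exact: (measurable_funTS mphi).
have gE y : S y -> g (phi y) = (f (y *m Q))%:E.
  by move=> Sy; rewrite /g /= patchE mem_set//; rewrite -phiS in Sy.
have ig : sigma.-integrable (phi @^-1` S) (g \o phi).
  rewrite phiS; apply: eq_integrable (integrable_sphere sigmaP bfQ) => //.
  by move=> y /[!inE] Sy; rewrite /comp gE.
have := integral_pushforward mphi mg ig mS.
rewrite phiS => h.
rewrite /Rintegral; congr fine.
transitivity (\int[sigma]_(y in S) (g \o phi) y)%E.
  by apply: eq_integral => y /[!inE] Sy; rewrite /= gE.
rewrite -h; transitivity (\int[sigma]_(y in S) g y)%E; last first.
  by apply: eq_integral => y /[!inE] Sy; rewrite /g /= patchE mem_set.
apply: eq_measure_integral => A mA _.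
rewrite /= /pushforward -(inv Q^T A rQt mA); congr (sigma _).
apply/seteqP; split => [y /= Ay|_ [y Ay <-]].
  by exists (phi y) => //; rewrite /phi -mulmxA QQ mulmx1.
by rewrite /= /phi -mulmxA QtQ mulmx1.
Qed.

End Invariance.

(** * Stein's identity *)

Section Stein.
Context {R : realType} {n : nat}.
Context (sigma : {measure set (borel_rV R n) -> \bar R}).
Context (sigmaP : normalized_sphere_measure sigma).
Implicit Types x y : 'rV[R]_n.

Notation S := (@usphere R n).
Notation E f := (Rintegral sigma (S : set (borel_rV R n)) f).

(** The mean of [phi(<x, y>) * (x_j y_i - x_i y_j)] composed with a rotation of
    the plane [(i, j)] does not depend on the angle; the claim is that its
    derivative at angle [0] vanishes. *)
Lemma stein_plane x (phi dphi : R -> R) (i j : 'I_n) : i != j ->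
  (forall s : R, `|s| <= enorm x -> is_derive s 1 phi (dphi s)) ->
  (forall s : R, `|s| <= enorm x -> {for s, continuous dphi}) ->
  E (fun y => dphi (dotv x y) * (x 0 j * y 0 i - x 0 i * y 0 j) ^+ 2 -
              phi (dotv x y) * (x 0 i * y 0 i + x 0 j * y 0 j)) = 0.
Proof.
move=> ij phid cdphi.
pose A y := x 0 i * y 0 i + x 0 j * y 0 j.
pose B y := x 0 j * y 0 i - x 0 i * y 0 j.
pose al (t : R) y := dotv x y + (cos t - 1) * A y + sin t * B y.
pose be (t : R) y := cos t * B y - sin t * A y.
pose dbe (t : R) y : R := - sin t * B y - cos t * A y.
(* Along the rotation <x, y> becomes al t y and x_j y_i - x_i y_j becomes
   be t y, which is the derivative of al. *)
have alE t y : al t y = dotv x (y *m plane_rot i j t).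
  rewrite plane_rotE !(dotvDr, dotvZr, dotvNr) !dotv_delta /al /A /B; ring.
have beE t y : be t y = x 0 j * (y *m plane_rot i j t) 0 i -
                        x 0 i * (y *m plane_rot i j t) 0 j.
  rewrite plane_rotE !mxE !eqxx (negbTE ij) eq_sym (negbTE ij) /be /A /B /=.
  by ring.
have al_le t y : S y -> `|al t y| <= enorm x.
  move=> Sy; rewrite alE; apply: ler_dotv.
  by rewrite /usphere/= /enorm rotation_dotv//; exact: plane_rotP.
have dal (t : R) y : is_derive t 1 (al^~ y) (be t y).
  apply: der_eq (derD (derD (der_cst _ _)
    (derM (derB (is_derive_cos t) (der_cst _ _)) (der_cst _ _)))
    (derM (is_derive_sin t) (der_cst _ _))) _.
  by rewrite /be; ring.
have dbed (t : R) y : is_derive t 1 (be^~ y) (dbe t y).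
  apply: der_eq (derB (derM (is_derive_cos t) (der_cst _ _))
    (derM (is_derive_sin t) (der_cst _ _))) _.
  by rewrite /dbe; ring.
pose k t y := phi (al t y) * be t y.
pose dk t y := dphi (al t y) * be t y * be t y + phi (al t y) * dbe t y.
have cA y : {for y, continuous A}.
  by apply: contD; apply: contM; try exact: cont_cst; exact: continuous_entry.
have cB y : {for y, continuous B}.
  by apply: contB; apply: contM; try exact: cont_cst; exact: continuous_entry.
have c1 (g : R -> R) (p : R * 'rV[R]_n) : continuous g ->
    {for p, continuous (fun q => g q.1)}.
  by move=> cg; apply: cont_comp; [exact: cg|exact: cvg_fst].
have c2 (g : 'rV[R]_n -> R) (p : R * 'rV[R]_n) : continuous g ->
    {for p, continuous (fun q => g q.2)}.
  by move=> cg; exact: (continuous_comp cvg_snd (cg p.2)).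
have ccos := @continuous_cos R; have csin := @continuous_sin R.
have cal (p : R * 'rV[R]_n) : {for p, continuous (fun q => al q.1 q.2)}.
  apply: contD; [apply: contD|apply: contM; [exact: c1|exact: c2]].
  - exact: c2 (@dotv_continuous R n x).
  - apply: contM; last exact: c2.
    by apply: contB; [exact: c1|exact: cont_cst].
have cbe (p : R * 'rV[R]_n) : {for p, continuous (fun q => be q.1 q.2)}.
  by apply: contB; apply: contM; [exact: c1|exact: c2|exact: c1|exact: c2].
have cdbe (p : R * 'rV[R]_n) : {for p, continuous (fun q => dbe q.1 q.2)}.
  apply: contB; apply: contM; [|exact: c2|exact: c1|exact: c2].
  by apply: contN; exact: c1.
have cphi (p : R * 'rV[R]_n) : S p.2 ->
    {for p, continuous (fun q => phi (al q.1 q.2))}.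
  move=> Sp; apply: cont_comp (cal p).
  exact: der_continuous (phid _ (al_le _ _ Sp)).
have cdphi' (p : R * 'rV[R]_n) : S p.2 ->
    {for p, continuous (fun q => dphi (al q.1 q.2))}.
  by move=> Sp; apply: cont_comp (cal p); exact: cdphi (al_le _ _ Sp).
have ck (p : R * 'rV[R]_n) : S p.2 -> {for p, continuous (fun q => k q.1 q.2)}.
  by move=> Sp; apply: contM; [exact: cphi|exact: cbe].
have cdk (p : R * 'rV[R]_n) : S p.2 -> {for p, continuous (fun q => dk q.1 q.2)}.
  move=> Sp; apply: contD; apply: contM; [|exact: cbe|exact: cphi|exact: cdbe].
  by apply: contM; [exact: cdphi'|exact: cbe].
have kd (t : R) y : S y -> is_derive t 1 (k^~ y) (dk t y).
  move=> Sy.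
  have h := @der_comp R phi (al^~ y) t _ _ (phid _ (al_le t y Sy)) (dal t y).
  exact: derM h (dbed t y).
have dE : is_derive (0 : R) 1 (fun t : R => E (fun y => k t y * 1)) (E (fun y => dk 0 y * 1)).
  apply: is_derive_mean => //.
  - exact: bounded_measurable_cst.
  - near=> t => y Sy; split; last exact: kd.
    by apply: continuous_slice; exact: ck.
  - by move=> y Sy; exact: (cdk (0, y) Sy).
have kcst t : E (fun y => k t y * 1) = E (fun y => phi (dotv x y) * B y).
  have bf : bounded_measurable (fun y => phi (dotv x y) * B y).
    apply: bounded_measurable_continuous => y Sy; apply: contM; last exact: cB.
    apply: cont_comp; last exact: dotv_continuous.
    exact: der_continuous (phid _ (ler_dotv _ Sy)).
  rewrite -(mean_rotation sigmaP (plane_rotP t ij) bf).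
  by apply: eq_mean => y _; rewrite mulr1 /k alE beE.
have E0 : E (fun y => dk 0 y * 1) = 0.
  have := der_eq (der_cst _ 0) (erefl (0 : R)) => /(_ (E (fun y => phi (dotv x y) * B y))).
  rewrite -(funext kcst) => h.
  by have := @derive_val _ _ _ _ _ _ _ dE; rewrite (@derive_val _ _ _ _ _ _ _ h).
have al0 y : al 0 y = dotv x y by rewrite /al cos0 sin0; ring.
rewrite -[RHS]E0; apply: eq_mean => y _.
by rewrite /dk al0 /dbe /be cos0 sin0 /A /B; ring.
Unshelve. all: by end_near. Qed.

(** Summing over the coordinate planes turns the squares into
    [|x|^2 |y|^2 - <x, y>^2] (Lagrange's identity).  The integrand is the
    Laplacian on the sphere of [Phi(<x, y>)], where [Phi' = phi]. *)
Lemma stein x (phi dphi : R -> R) :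
  (forall s : R, `|s| <= enorm x -> is_derive s 1 phi (dphi s)) ->
  (forall s : R, `|s| <= enorm x -> {for s, continuous dphi}) ->
  E (fun y => (dotv x x - dotv x y ^+ 2) * dphi (dotv x y) -
              (n%:R - 1) * dotv x y * phi (dotv x y)) = 0.
Proof.
move=> phid cdphi.
(* The diagonal terms, which belong to no plane, are set to 0. *)
pose T i j y := dphi (dotv x y) * (x 0 j * y 0 i - x 0 i * y 0 j) ^+ 2 -
              phi (dotv x y) * (if i == j then 0 else (x 0 i * y 0 i + x 0 j * y 0 j)).
have cT i j y : S y -> {for y, continuous (T i j)}.
  move=> Sy.
  have cd := @dotv_continuous R n x y.
  have ce l : {for y, continuous (fun z : 'rV[R]_n => z 0 l)}.
    exact: continuous_entry.
  apply: contB; apply: contM.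
  - by apply: cont_comp => //; exact: cdphi (ler_dotv _ Sy).
  - by apply: contX; apply: contB; apply: contM; try exact: cont_cst; exact: ce.
  - by apply: cont_comp => //; exact: der_continuous (phid _ (ler_dotv _ Sy)).
  - case: (i == j); first exact: cont_cst.
    by apply: contD; apply: contM; try exact: cont_cst; exact: ce.
have bT i j : bounded_measurable (T i j).
  by apply: bounded_measurable_continuous; exact: cT.
have ET i j : E (T i j) = 0.
  have [->|ij] := eqVneq i j.
    rewrite -[RHS](mean_cst sigmaP); apply: eq_mean => y _.
    by rewrite /T eqxx subrr expr0n !mulr0 subr0.
  rewrite -[RHS](stein_plane ij phid cdphi); apply: eq_mean => y _.
  by rewrite /T (negbTE ij).
have : E (fun y => 2^-1 * \sum_i \sum_j T i j y) = 0.
  rewrite (meanZ sigmaP); last first.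
    by apply: bounded_measurable_sum => i; apply: bounded_measurable_sum.
  rewrite (mean_sum sigmaP); last by move=> i; exact: bounded_measurable_sum.
  rewrite big1 ?mulr0// => i _.
  by rewrite (mean_sum sigmaP)//; rewrite big1.
move=> <-; apply: eq_mean => y /usphereP y1.
have -> : \sum_i \sum_j T i j y = dphi (dotv x y) *
     \sum_i \sum_j (x 0 j * y 0 i - x 0 i * y 0 j) ^+ 2 -
     phi (dotv x y) * \sum_i \sum_j
       (if i == j then 0 else (x 0 i * y 0 i + x 0 j * y 0 j)).
  rewrite !mulr_sumr -sumrB; apply: eq_bigr => i _.
  by rewrite !mulr_sumr -sumrB.
have -> : \sum_i \sum_j (if i == j then 0 else (x 0 i * y 0 i + x 0 j * y 0 j)) =
    2 * (n%:R - 1) * dotv x y.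
  have -> : 2 * (n%:R - 1) * dotv x y = \sum_i
      (n%:R * (x 0 i * y 0 i) + dotv x y - 2 * (x 0 i * y 0 i)).
    rewrite sumrB big_split/= sumr_const card_ord -!mulr_sumr -/(dotv x y).
    by rewrite -mulr_natl; ring.
  apply: eq_bigr => i _.
  have -> : n%:R * (x 0 i * y 0 i) + dotv x y = \sum_j (x 0 i * y 0 i + x 0 j * y 0 j).
    by rewrite big_split/= sumr_const card_ord mulr_natl.
  rewrite (bigD1 i)//= eqxx add0r [in RHS](bigD1 i)//=.
  rewrite (eq_bigr (fun j => x 0 i * y 0 i + x 0 j * y 0 j)) => [|j ji].
    by ring.
  by rewrite eq_sym (negbTE ji).
have := lagrange_identity x y; rewrite y1 mulr1 => ->.
by field.
Qed.

End Stein.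

(** * Harmonicity of Poisson integrals *)

Section Partial.
Context {R : realType} {n : nat}.
Context (sigma : {measure set (borel_rV R n) -> \bar R}).
Context (sigmaP : normalized_sphere_measure sigma).
Implicit Types x y : 'rV[R]_n.

Notation S := (@usphere R n).
Notation E f := (Rintegral sigma (S : set (borel_rV R n)) f).

Lemma is_derive_line (F : 'rV[R]_n -> R) x v (d : R) :
  is_derive (0 : R) 1 (fun h : R => F (h *: v + x)) d -> is_derive x v F d.
Proof.
move=> [d1 d2].
have gE : (fun h : R => h^-1 *: ((F \o shift x) (h *: v) - F x)) =
    (fun h : R => h^-1 *: (((fun h : R => F (h *: v + x)) \o shift 0) (h *: 1) -
        F (0 *: v + x))).
  by apply/funext => h; rewrite /= addr0 scale0r add0r [h%:A]mulr1.
by constructor; rewrite /derivable /derive gE.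
Qed.

Lemma is_derive_partial_mean (G G' : 'rV[R]_n -> 'rV[R]_n -> R) (i : 'I_n)
    (f : 'rV[R]_n -> R) x :
  bounded_measurable f -> uball x ->
  (forall z y, uball z -> S y ->
     is_derive (0 : R) 1 (fun h : R => G (h *: delta_mx 0 i + z) y) (G' z y)) ->
  (forall z y, uball z -> S y -> {for (z, y), continuous (fun p => G p.1 p.2)}) ->
  (forall z y, uball z -> S y -> {for (z, y), continuous (fun p => G' p.1 p.2)}) ->
  is_derive x (delta_mx 0 i) (fun z => E (fun y => G z y * f y))
    (E (fun y => G' x y * f y)).
Proof.
move=> bf bx dG cG cG'; apply: is_derive_line.
pose w (t : R) : 'rV[R]_n := t *: delta_mx 0 i + x.
have w0 : w 0 = x by rewrite /w scale0r add0r.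
have cw (t : R) : {for t, continuous w}.
  by apply: cvgD; [apply: cvgZr_tmp; exact: cvg_id|exact: cvg_cst].
have nw : \forall t \near (0 : R), uball (w t).
  by apply: (cw 0); apply: open_nbhs_nbhs; split; [exact: open_uball|rewrite w0].
rewrite -[X in E (fun y => G' X y * _)]w0.
apply: (@is_derive_mean _ _ _ sigmaP (fun t => G (w t)) (fun t => G' (w t))) => //.
- near=> t => y Sy; have bt : uball (w t) by near: t.
  split; first exact: continuous_slice (cG _ _ bt Sy).
  have := @der_comp R (fun h => G (h *: delta_mx 0 i + w t) y) (fun u => u - t) t
      (G' (w t) y) 1.
  rewrite mulr1 subrr => /(_ (dG _ _ bt Sy)).
  have -> : (fun u => G ((u - t) *: delta_mx 0 i + w t) y) = (fun u => G (w u) y).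
    by apply/funext => u; rewrite /w addrA -scalerDl subrK.
  apply; apply: der_eq (derB (der_id _) (der_cst _ _)) _.
  by rewrite subr0.
- move=> y Sy.
  apply: (@continuous_comp _ _ _ (fun p : R * 'rV[R]_n => (w p.1, p.2))
     (fun p => G' p.1 p.2)); last by rewrite /= w0; apply: cG'.
  apply: (@cvg_pair _ _ _ (nbhs (0 : R, y)) (nbhs (w 0)) (nbhs y)).
    exact: (cvg_comp (fun p : R * 'rV[R]_n => p.1) w cvg_fst (cw 0)).
  exact: cvg_snd.
Unshelve. all: by end_near. Qed.

End Partial.

Section PoissonKernel.
Context {R : realType} {n : nat}.
Implicit Types x y z : 'rV[R]_n.

Notation S := (@usphere R n).

Definition distN (m : nat) x y : R := enorm (x - y) ^- m.

Definition poisson x y : R := (1 - enorm x ^+ 2) * distN n x y.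

(** The partial derivative of the Poisson kernel in the [i]-th variable of [x];
    [poisson2] is the second one, in the variables [i] and [j]. *)
Definition poisson1 (i : 'I_n) x y : R :=
  - 2 * x 0 i * distN n x y
  - n%:R * (1 - enorm x ^+ 2) * (x 0 i - y 0 i) * distN n.+2 x y.

Definition poisson2 (i j : 'I_n) x y : R :=
  - 2 * (i == j)%:R * distN n x y
  + 2 * n%:R * (x 0 i * (x 0 j - y 0 j) + x 0 j * (x 0 i - y 0 i)) * distN n.+2 x y
  - n%:R * (1 - enorm x ^+ 2) * (i == j)%:R * distN n.+2 x y
  + n%:R * (n%:R + 2) * (1 - enorm x ^+ 2) * (x 0 i - y 0 i) * (x 0 j - y 0 j) *
    distN n.+4 x y.

Lemma dist_gt0 x y : uball x -> S y -> 0 < enorm (x - y).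
Proof. by move=> bx Sy; rewrite sqrtr_gt0; exact: dist_sphere_gt0. Qed.

Lemma distNS2 m x y : uball x -> S y ->
  distN m x y = dotv (x - y) (x - y) * distN m.+2 x y.
Proof.
move=> bx Sy; have r0 := dist_gt0 bx Sy.
rewrite /distN -sqr_enorm !exprS; field.
by rewrite expf_neq0 ?gt_eqF.
Qed.

Lemma poisson_gt0 x y : uball x -> S y -> 0 < poisson x y.
Proof.
move=> bx Sy; rewrite mulr_gt0//; last by rewrite invr_gt0 exprn_gt0// dist_gt0.
by rewrite sqr_enorm subr_gt0; exact/uballP.
Qed.

Lemma cont_distN m x y : uball x -> S y ->
  {for (x, y), continuous (fun p => distN m p.1 p.2)}.
Proof.
move=> bx Sy.
have c : {for (x, y), continuous (fun p : 'rV[R]_n * 'rV[R]_n => p.1 - p.2)}.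
  by apply: cvgB; [exact: cvg_fst|exact: cvg_snd].
apply: contV; first by rewrite expf_neq0// gt_eqF// dist_gt0.
by apply: contX; exact: (continuous_comp c (@enorm_continuous R n _)).
Qed.

Lemma cont_fst_entry (i : 'I_n) (p : 'rV[R]_n * 'rV[R]_n) :
  {for p, continuous (fun q : 'rV[R]_n * 'rV[R]_n => q.1 0 i)}.
Proof. by apply: cont_entry; exact: cvg_fst. Qed.

Lemma cont_snd_entry (i : 'I_n) (p : 'rV[R]_n * 'rV[R]_n) :
  {for p, continuous (fun q : 'rV[R]_n * 'rV[R]_n => q.2 0 i)}.
Proof. by apply: cont_entry; exact: cvg_snd. Qed.

Lemma cont_fst_enorm (p : 'rV[R]_n * 'rV[R]_n) :
  {for p, continuous (fun q => enorm q.1)}.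
Proof. exact: (continuous_comp cvg_fst (@enorm_continuous R n _)). Qed.

Ltac cont_kernel := cont_arith ltac:(first
  [ exact: cont_distN | exact: cont_fst_enorm | exact: cont_fst_entry
  | exact: cont_snd_entry | exact: cont_cst ]).

Lemma cont_poisson x y : uball x -> S y ->
  {for (x, y), continuous (fun p => poisson p.1 p.2)}.
Proof. by move=> bx Sy; rewrite /poisson; cont_kernel. Qed.

Lemma cont_poisson1 i x y : uball x -> S y ->
  {for (x, y), continuous (fun p => poisson1 i p.1 p.2)}.
Proof. by move=> bx Sy; rewrite /poisson1; cont_kernel. Qed.

Lemma cont_poisson2 i j x y : uball x -> S y ->
  {for (x, y), continuous (fun p => poisson2 i j p.1 p.2)}.
Proof. by move=> bx Sy; rewrite /poisson2; cont_kernel. Qed.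

Lemma der_entry (i j : 'I_n) x :
  is_derive (0 : R) 1 (fun h : R => (h *: delta_mx 0 j + x) 0 i) (i == j)%:R.
Proof.
have -> : (fun h : R => (h *: delta_mx 0 j + x) 0 i) =
   (fun h => h * (i == j)%:R + x 0 i).
  by apply/funext => h; rewrite !mxE eqxx.
apply: der_eq (derD (derM (der_id _) (der_cst _ _)) (der_cst _ _)) _.
by ring.
Qed.

Lemma der_dotvv (j : 'I_n) x :
  is_derive (0 : R) 1
    (fun h : R => dotv (h *: delta_mx 0 j + x) (h *: delta_mx 0 j + x))
    (2 * x 0 j).
Proof.
have -> : (fun h : R => dotv (h *: delta_mx 0 j + x) (h *: delta_mx 0 j + x)) =
   (fun h => h ^+ 2 + h * (2 * x 0 j) + dotv x x).
  apply/funext => h; rewrite !(dotvDl, dotvDr, dotvZl, dotvZr) !dotv_delta.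
  by rewrite (dotvC (delta_mx 0 j) x) dotv_delta mxE !eqxx /=; ring.
apply: der_eq (derD (derD (derX 2 (der_id _))
  (derM (der_id _) (der_cst _ _))) (der_cst _ _)) _.
by rewrite /=; ring.
Qed.

Lemma der_distN m (j : 'I_n) x y : uball x -> S y ->
  is_derive (0 : R) 1 (fun h : R => distN m (h *: delta_mx 0 j + x) y)
    (- m%:R * (x 0 j - y 0 j) * distN m.+2 x y).
Proof.
move=> bx Sy; rewrite /distN.
have -> : (fun h : R => enorm (h *: delta_mx 0 j + x - y) ^- m) =
   (fun h : R => Num.sqrt (dotv (h *: delta_mx 0 j + (x - y))
                                (h *: delta_mx 0 j + (x - y))) ^- m).
  by apply/funext => h; rewrite /enorm addrA.
have q0 := dist_sphere_gt0 bx Sy.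
have := der_sqrtXN m (der_dotvv j (x - y)).
rewrite scale0r add0r !mxE -/(enorm _) => /(_ q0) h.
by apply: der_eq h _; field; rewrite expf_neq0// gt_eqF// dist_gt0.
Qed.

Lemma der_sqr_enorm (j : 'I_n) x :
  is_derive (0 : R) 1 (fun h : R => enorm (h *: delta_mx 0 j + x) ^+ 2)
    (2 * x 0 j).
Proof.
by under eq_fun do rewrite sqr_enorm; exact: der_dotvv.
Qed.

Lemma der_poisson (j : 'I_n) x y : uball x -> S y ->
  is_derive (0 : R) 1 (fun h : R => poisson (h *: delta_mx 0 j + x) y)
    (poisson1 j x y).
Proof.
move=> bx Sy; rewrite /poisson.
apply: der_eq (derM (derB (der_cst _ _) (der_sqr_enorm j x))
  (der_distN n j bx Sy)) _.
by rewrite scale0r !add0r /poisson1; ring.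
Qed.

Lemma der_poisson1 (i j : 'I_n) x y : uball x -> S y ->
  is_derive (0 : R) 1 (fun h : R => poisson1 i (h *: delta_mx 0 j + x) y)
    (poisson2 i j x y).
Proof.
move=> bx Sy; rewrite /poisson1.
have d1 := derM (derM (der_cst (- 2) (0 : R)) (der_entry i j x)) (der_distN n j bx Sy).
have d2 := derM (derM (derM (der_cst n%:R (0 : R))
   (derB (der_cst 1 (0 : R)) (der_sqr_enorm j x)))
   (derB (der_entry i j x) (der_cst (y 0 i) (0 : R)))) (der_distN n.+2 j bx Sy).
apply: der_eq (derB d1 d2) _.
rewrite scale0r !add0r /poisson2 -(natrD _ n 2) addn2.
by ring.
Qed.

(** The Poisson kernel is harmonic in [x]: with [q = |x - y|^2] every term is a
    multiple of [q^(-n/2-2)], and the coefficients cancel because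
    [2 <x, x - y> + 1 - |x|^2 = q]. *)
Lemma poisson2_trace x y : uball x -> S y -> \sum_i poisson2 i i x y = 0.
Proof.
move=> bx Sy.
have x1 := bx; have y1 := Sy; move/usphereP: y1 => y1.
have -> : \sum_i poisson2 i i x y =
  - 2 * n%:R * distN n x y
  + 4 * n%:R * dotv x (x - y) * distN n.+2 x y
  - n%:R * (1 - enorm x ^+ 2) * n%:R * distN n.+2 x y
  + n%:R * (n%:R + 2) * (1 - enorm x ^+ 2) * dotv (x - y) (x - y) * distN n.+4 x y.
  have cst (c : R) : n%:R * c = \sum_(i < n) c.
    by rewrite sumr_const card_ord mulr_natl.
  have -> : - 2 * n%:R * distN n x y = n%:R * (- 2 * distN n x y) by ring.
  have -> : n%:R * (1 - enorm x ^+ 2) * n%:R * distN n.+2 x y =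
     n%:R * (n%:R * (1 - enorm x ^+ 2) * distN n.+2 x y) by ring.
  rewrite !(cst (_ * _)) /dotv !mulr_sumr !mulr_suml -sumrN -!big_split/=.
  apply: eq_bigr => i _; rewrite /poisson2 eqxx !mxE /=.
  by ring.
rewrite (distNS2 n bx Sy) (distNS2 n.+2 bx Sy) sqr_enorm.
by rewrite dotv_sub y1 dotvDr dotvNr; ring.
Qed.

End PoissonKernel.

Section PoissonIntegral.
Context {R : realType} {n : nat}.
Context (sigma : {measure set (borel_rV R n) -> \bar R}).
Context (sigmaP : normalized_sphere_measure sigma).
Implicit Types x y : 'rV[R]_n.
Context (f : 'rV[R]_n -> R) (bf : bounded_measurable f).

Notation S := (@usphere R n).
Notation E f := (Rintegral sigma (S : set (borel_rV R n)) f).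

Lemma is_derive_poisson_integral i x : uball x ->
  is_derive x (delta_mx 0 i) (fun z => E (fun y => poisson z y * f y))
    (E (fun y => poisson1 i x y * f y)).
Proof.
move=> bx; apply: (is_derive_partial_mean sigmaP bf bx) => z y bz Sy.
- exact: der_poisson.
- exact: cont_poisson.
- exact: cont_poisson1.
Qed.

Lemma near_uball x : uball x -> \forall z \near x, uball z.
Proof. by move=> bx; apply: open_nbhs_nbhs; split => //; exact: open_uball. Qed.

Lemma is_derive_partial_poisson_integral i j x : uball x ->
  is_derive x (delta_mx 0 j)
    (partial i (fun z => E (fun y => poisson z y * f y)))
    (E (fun y => poisson2 i j x y * f y)).
Proof.
move=> bx.
apply: (@near_eq_is_derive _ _ _ (fun z => E (fun y => poisson1 i z y * f y))).
  apply: filterS (near_uball bx) => z bz.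
  by rewrite /partial; have [_ ->] := is_derive_poisson_integral i bz.
apply: (is_derive_partial_mean sigmaP bf bx) => z y bz Sy.
- exact: der_poisson1.
- exact: cont_poisson1.
- exact: cont_poisson2.
Qed.

Lemma harmonic_poisson_integral :
  harmonic_on (@uball R n) (fun z => E (fun y => poisson z y * f y)).
Proof.
have d2E i j x : uball x ->
   partial j (partial i (fun z => E (fun y => poisson z y * f y))) x =
   E (fun y => poisson2 i j x y * f y).
  by move=> bx; have [_] := is_derive_partial_poisson_integral i j bx.
split=> x bx; last first.
  rewrite /laplacian (eq_bigr (fun i => E (fun y => poisson2 i i x y * f y))).
    rewrite -(mean_sum sigmaP).
      rewrite -[RHS](mean_cst sigmaP); apply: eq_mean => y Sy.
      by rewrite -mulr_suml poisson2_trace// mul0r.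
    move=> i; apply: bounded_measurableM => //.
    apply: bounded_measurable_continuous => y Sy.
    exact: (continuous_slice (cont_poisson2 bx Sy)).
  by move=> i _; exact: d2E.
move=> i j; split.
- by have [] := is_derive_poisson_integral i bx.
- by have [] := is_derive_partial_poisson_integral i j bx.
have c : {for x, continuous (fun z => E (fun y => poisson2 i j z y * f y))}.
  apply: (continuous_mean sigmaP) => //.
    apply: filterS (near_uball bx) => z bz y Sy.
    exact: (continuous_slice (cont_poisson2 bz Sy)).
  by move=> y Sy; exact: cont_poisson2.
rewrite /prop_for /continuous_at d2E//.
have near_d2E : \forall z \near x, E (fun y => poisson2 i j z y * f y) =
    partial j (partial i (fun z => E (fun y => poisson z y * f y))) z.
  by apply: filterS (near_uball bx) => z bz; rewrite d2E.
exact: cvg_trans (near_eq_cvg near_d2E) c.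
Qed.

End PoissonIntegral.

(** * The Poisson kernel has mean one *)

Section PoissonTotal.
Context {R : realType} {n : nat}.
Context (sigma : {measure set (borel_rV R n) -> \bar R}).
Context (sigmaP : normalized_sphere_measure sigma).
Implicit Types x y : 'rV[R]_n.

Notation S := (@usphere R n).
Notation E f := (Rintegral sigma (S : set (borel_rV R n)) f).

Lemma is_derive_mean1 (k dk : R -> 'rV[R]_n -> R) (t0 : R) :
  (\forall t \near t0, forall y, S y ->
     {for y, continuous (k t)} /\ is_derive t 1 (k^~ y) (dk t y)) ->
  (forall y, S y -> {for (t0, y), continuous (fun p => dk p.1 p.2)}) ->
  is_derive t0 1 (fun t => E (k t)) (E (dk t0)).
Proof.
move=> nk cdk.
have := is_derive_mean sigmaP (bounded_measurable_cst 1) nk cdk.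
have m1 (g : 'rV[R]_n -> R) : E (fun y => g y * 1) = E g.
  by apply: eq_mean => y _; rewrite mulr1.
by under eq_fun do rewrite m1; rewrite m1.
Qed.

Context (x : 'rV[R]_n) (bx : uball x).
Let a := dotv x x.

(** [|t x - y|^-m] for a unit vector [y] with [<x, y> = s]. *)
Let Q (m : nat) (t s : R) : R := Num.sqrt (1 - 2 * t * s + t ^+ 2 * a) ^- m.

Let Q_gt0 (t s : R) : uball (t *: x) -> `|s| <= enorm x ->
  0 < 1 - 2 * t * s + t ^+ 2 * a.
Proof.
move=> /uballP; rewrite dotvZl dotvZr mulrA -expr2 -/a => ta sx.
have : s ^+ 2 <= a.
  by rewrite /a -sqr_enorm -[s ^+ 2]ger0_norm ?sqr_ge0// normrX lerXn2r// nnegrE// enorm_ge0.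
rewrite -subr_ge0 => sa; have ta0 := mulr_ge0 (sqr_ge0 t) sa.
have ts1 : t * s < 1.
  rewrite (le_lt_trans (ler_norm _))// -(@expr_lt1 _ 2)// -normrX ger0_norm ?sqr_ge0//.
  by rewrite exprMn (le_lt_trans _ ta)// -subr_ge0 -mulrBr.
have : 0 < (1 - t * s) ^+ 2 by rewrite exprn_gt0// subr_gt0.
move: ta0; move: (a) => b; nra.
Qed.

Let dQ_t m (t s : R) : uball (t *: x) -> `|s| <= enorm x ->
  is_derive t 1 (fun t => Q m t s) (- m%:R * (t * a - s) * Q m.+2 t s).
Proof.
move=> bt sx.
have d : is_derive t 1 (fun t : R => 1 - 2 * t * s + t ^+ 2 * a) (2 * (t * a - s)).
  apply: der_eq (derD (derB (der_cst _ _) (derM (derM (der_cst _ _) (der_id _))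
     (der_cst _ _))) (derM (derX 2 (der_id _)) (der_cst _ _))) _.
  by rewrite /=; ring.
have h := der_sqrtXN m d (Q_gt0 bt sx); apply: der_eq h _.
by rewrite -/(Q _ _ _); field.
Qed.

Let dQ_s m t (s : R) : uball (t *: x) -> `|s| <= enorm x ->
  is_derive s 1 (fun s => Q m t s) (m%:R * t * Q m.+2 t s).
Proof.
move=> bt sx.
have d : is_derive s 1 (fun s : R => 1 - 2 * t * s + t ^+ 2 * a) (- 2 * t).
  apply: der_eq (derD (derB (der_cst _ _) (derM (der_cst _ _) (der_id _)))
    (der_cst _ _)) _.
  by ring.
have h := der_sqrtXN m d (Q_gt0 bt sx); apply: der_eq h _.
by rewrite -/(Q _ _ _); field.
Qed.

Let QS2 m t s : uball (t *: x) -> `|s| <= enorm x ->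
  Q m t s = (1 - 2 * t * s + t ^+ 2 * a) * Q m.+2 t s.
Proof.
move=> bt sx; have q0 := Q_gt0 bt sx.
rewrite /Q -[X in _ = X * _](sqr_sqrtr (ltW q0)).
have := sqrtr_gt0 (1 - 2 * t * s + t ^+ 2 * a); rewrite q0.
move: (Num.sqrt _) => r r0; rewrite !exprS; field.
by rewrite expf_neq0 ?gt_eqF.
Qed.

Let cQ m (X : topologicalType) (f g : X -> R) (p : X) :
  uball (f p *: x) -> `|g p| <= enorm x ->
  {for p, continuous f} -> {for p, continuous g} ->
  {for p, continuous (fun q => Q m (f q) (g q))}.
Proof.
move=> bt sx cf cg; apply: contV.
  by rewrite expf_neq0// gt_eqF// sqrtr_gt0 Q_gt0.
apply: contX; apply: cont_comp; first exact: sqrt_continuous.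
apply: contD; last by apply: contM; [exact: contX|exact: cont_cst].
apply: contB; first exact: cont_cst.
by apply: contM => //; apply: contM => //; exact: cont_cst.
Qed.

(** [k t s] is the Poisson kernel at [t x] and [y], with [s = <x, y>]; [k1] and
    [k2] are its derivatives in [t], and [phi] and [dphi] those in [s]. *)
Let k (t s : R) := (1 - t ^+ 2 * a) * Q n t s.
Let k1 (t s : R) := - 2 * a * t * Q n t s -
  n%:R * (1 - t ^+ 2 * a) * (t * a - s) * Q n.+2 t s.
Let k2 (t s : R) := - 2 * a * Q n t s + 4 * n%:R * t * a * (t * a - s) * Q n.+2 t s
  - n%:R * a * (1 - t ^+ 2 * a) * Q n.+2 t s
  + n%:R * (n%:R + 2) * (1 - t ^+ 2 * a) * (t * a - s) ^+ 2 * Q n.+4 t s.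
Let phi (t s : R) := n%:R * t * (1 - t ^+ 2 * a) * Q n.+2 t s.
Let dphi (t s : R) := n%:R * (n%:R + 2) * t ^+ 2 * (1 - t ^+ 2 * a) * Q n.+4 t s.

Let dk (t s : R) : uball (t *: x) -> `|s| <= enorm x ->
  is_derive t 1 (k^~ s) (k1 t s).
Proof.
move=> bt sx; rewrite /k.
have d := derB (der_cst 1 t) (derM (derX 2 (der_id t)) (der_cst a t)).
apply: der_eq (derM d (dQ_t n bt sx)) _.
by rewrite /k1 /=; ring.
Qed.

Let dk1 (t s : R) : uball (t *: x) -> `|s| <= enorm x ->
  is_derive t 1 (k1^~ s) (k2 t s).
Proof.
move=> bt sx; rewrite /k1.
have d := derB (der_cst 1 t) (derM (derX 2 (der_id t)) (der_cst a t)).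
have d1 := derM (derM (der_cst (- 2 * a) t) (der_id t)) (dQ_t n bt sx).
have d2 := derM (derM (derM (der_cst n%:R t) d)
  (derB (derM (der_id t) (der_cst a t)) (der_cst s t))) (dQ_t n.+2 bt sx).
apply: der_eq (derB d1 d2) _.
by rewrite /k2 /= -(natrD _ n 2) addn2; ring.
Qed.

Let dphiP t (s : R) : uball (t *: x) -> `|s| <= enorm x ->
  is_derive s 1 (phi t) (dphi t s).
Proof.
move=> bt sx; rewrite /phi.
apply: der_eq (derM (der_cst _ _) (dQ_s n.+2 bt sx)) _.
by rewrite /dphi -(natrD _ n 2) addn2; ring.
Qed.

(** Laplace's equation in the coordinates [t] and [s]: the radial part on the
    left, and the spherical part, which is an integrand of Stein's identity, on
    the right. *)
Let laplace_ts t s : uball (t *: x) -> `|s| <= enorm x ->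
  t ^+ 2 * k2 t s + (n%:R - 1) * t * k1 t s =
  - ((a - s ^+ 2) * dphi t s - (n%:R - 1) * s * phi t s).
Proof.
move=> bt sx; rewrite /k2 /k1 /dphi /phi.
by rewrite (QS2 n bt sx) (QS2 n.+2 bt sx); ring.
Qed.

Let ck m t (y : 'rV[R]_n) : uball (t *: x) -> S y ->
  {for (t, y), continuous (fun p : R * 'rV[R]_n => Q m p.1 (dotv x p.2))}.
Proof.
move=> bt Sy; apply: cQ => //=; first exact: ler_dotv.
- exact: cvg_fst.
- by apply: cont_dotv; [exact: cst_continuous|exact: cvg_snd].
Qed.

Let c_t (p : R * 'rV[R]_n) : {for p, continuous (fun p => p.1 : R)}.
Proof. exact: cvg_fst. Qed.

Let c_s (p : R * 'rV[R]_n) : {for p, continuous (fun p => dotv x p.2)}.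
Proof. by apply: cont_dotv; [exact: cst_continuous|exact: cvg_snd]. Qed.

Ltac cont_ts := cont_arith ltac:(first
  [ exact: ck | exact: c_t | exact: c_s | exact: cont_cst ]).

Let c_k t y : uball (t *: x) -> S y ->
  {for (t, y), continuous (fun p => k p.1 (dotv x p.2))}.
Proof. by move=> bt Sy; rewrite /k; cont_ts. Qed.

Let c_k1 t y : uball (t *: x) -> S y ->
  {for (t, y), continuous (fun p => k1 p.1 (dotv x p.2))}.
Proof. by move=> bt Sy; rewrite /k1; cont_ts. Qed.

Let c_k2 t y : uball (t *: x) -> S y ->
  {for (t, y), continuous (fun p => k2 p.1 (dotv x p.2))}.
Proof. by move=> bt Sy; rewrite /k2; cont_ts. Qed.

Let near_t t : uball (t *: x) -> \forall u \near t, uball (u *: x).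
Proof.
move=> bt; have c : (fun u : R => u *: x) @ t --> t *: x.
  by apply: cvgZr_tmp; exact: cvg_id.
by apply: c; apply: open_nbhs_nbhs; split => //; exact: open_uball.
Qed.

Let unit_t t : 0 <= t <= 1 -> uball (t *: x).
Proof.
move=> /andP[t0 t1]; apply/uballP; rewrite dotvZl dotvZr mulrA -expr2.
have /uballP ax := bx; have := dotvv_ge0 x; rewrite (le_lt_trans _ ax)//.
by rewrite ler_piMl// ?dotvv_ge0// expr_le1.
Qed.

(** By [laplace_ts] the derivative of [t^(n-1) k1] in [t] is [- t^(n-3)] times the
    integrand of Stein's identity. *)
Let moment_cst (m : nat) t : n = m.+3 -> uball (t *: x) ->
  is_derive t 1 (fun t => E (fun y => t ^+ m.+2 * k1 t (dotv x y))) 0.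
Proof.
move=> nm bt.
pose dg t s := t ^+ m * (t ^+ 2 * k2 t s + (n%:R - 1) * t * k1 t s).
apply: der_eq; first apply: (@is_derive_mean1
  (fun t y => t ^+ m.+2 * k1 t (dotv x y)) (fun t y => dg t (dotv x y)) t).
- apply: filterS (near_t bt) => u bu y Sy; split.
    apply: contM; first exact: cont_cst.
    exact: (continuous_slice (G := fun u y => k1 u (dotv x y))) (c_k1 bu Sy).
  apply: der_eq (derM (derX m.+2 (der_id u)) (dk1 bu (ler_dotv x Sy))) _.
  have nR : n%:R - 1 = m.+2%:R :> R by rewrite nm -[m.+3]addn1 natrD addrK.
  by rewrite /dg /= nR !exprS; ring.
- move=> y Sy; rewrite /dg.
  apply: contM; first by apply: contX; exact: c_t.
  apply: contD; first by apply: contM; [apply: contX; exact: c_t|exact: c_k2].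
  apply: contM; last exact: c_k1.
  by apply: contM; [exact: cont_cst|exact: c_t].
have := stein sigmaP (x := x) (phi := phi t) (dphi := dphi t).
move=> /(_ (fun s sx => dphiP bt sx)) st.
have cd s : `|s| <= enorm x -> {for s, continuous (dphi t)}.
  move=> sx; apply: contM; first exact: cont_cst.
  by apply: cQ => //; exact: cst_continuous.
rewrite -[RHS](mulr0 (- t ^+ m)) -(st cd) -(meanZ sigmaP).
  by apply: eq_mean => y Sy; rewrite /dg laplace_ts ?ler_dotv// mulrN mulNr.
apply: bounded_measurable_continuous => y Sy.
have c1 : {for y, continuous (dotv x)} := @dotv_continuous R n x y.
have sx := ler_dotv x Sy.
apply: contB; apply: contM.
- by apply: contB; [exact: cont_cst|exact: contX].
- by apply: cont_comp => //; exact: cd.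
- by apply: contM => //; exact: cont_cst.
- by apply: cont_comp => //; exact: der_continuous (dphiP bt sx).
Qed.

(** The mean of the kernel at [t x] has a derivative in [t] whose product with
    [t^(n-1)] is constant, hence zero as it vanishes at [t = 0].  So the mean is
    the same at [x] as at the centre, where the kernel is [1]. *)
Lemma poisson_total : (3 <= n)%N -> E (poisson x) = 1.
Proof.
move=> n3; have [m nm] : exists m, n = m.+3 by exists (n - 3)%N; rewrite -addn3 subnK.
pose psi t := E (fun y => k t (dotv x y)).
pose psi1 t := E (fun y => k1 t (dotv x y)).
have dpsi t : uball (t *: x) -> is_derive t 1 psi (psi1 t).
  move=> bt.
  apply: (is_derive_mean1 (k := fun t y => k t (dotv x y))
                       (dk := fun t y => k1 t (dotv x y))).
    apply: filterS (near_t bt) => u bu y Sy; split.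
      exact: (continuous_slice (G := fun u y => k u (dotv x y))) (c_k bu Sy).
    exact: dk bu (ler_dotv x Sy).
  by move=> y Sy; exact: c_k1.
have psi1_0 t : 0 < t <= 1 -> psi1 t = 0.
  move=> /andP[t0 t1].
  pose M (t : R) := E (fun y => t ^+ m.+2 * k1 t (dotv x y)).
  have ME u : uball (u *: x) -> M u = u ^+ m.+2 * psi1 u.
    move=> bu; rewrite /M (meanZ sigmaP)//.
    apply: bounded_measurable_continuous => y Sy.
    exact: (continuous_slice (G := fun u y => k1 u (dotv x y))) (c_k1 bu Sy).
  have [||c _] := @MVT_segment _ M (fun=> 0) 0 t (ltW t0).
  - move=> u; rewrite in_itv/= => /andP[u0 ut]; apply: moment_cst nm _.
    by apply: unit_t; rewrite !ltW// (lt_le_trans ut).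
  - apply: derivable_within_continuous => u; rewrite in_itv/= => /andP[u0 ut].
    have bu : uball (u *: x) by apply: unit_t; rewrite u0 (le_trans ut).
    by case: (moment_cst nm bu).
  rewrite mul0r !ME; last 2 first.
  - by apply: unit_t; rewrite lexx ler01.
  - by apply: unit_t; rewrite (ltW t0).
  rewrite expr0n mul0r subr0 => /eqP.
  by rewrite mulf_eq0 expf_eq0 gt_eqF//= => /eqP.
have psi10 : psi 1 = psi 0.
  apply/eqP; rewrite -subr_eq0; apply/eqP.
  have [||c _ ->] := @MVT_segment _ psi (fun=> 0) 0 1 ler01.
  - move=> u; rewrite in_itv/= => /andP[u0 u1].
    rewrite -(psi1_0 u) ?u0 ?ltW//; apply: dpsi.
    by apply: unit_t; rewrite !ltW.
  - apply: derivable_within_continuous => u; rewrite in_itv/= => ub.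
    by case: (dpsi _ (unit_t ub)).
  by rewrite mul0r.
rewrite -[RHS](mean_cst sigmaP 1) -/(psi 1).
have psi0 : psi 0 = 1.
  rewrite -[RHS](mean_cst sigmaP); apply: eq_mean => y _.
  rewrite /k /Q (_ : 1 - 2 * 0 * dotv x y + 0 ^+ 2 * a = 1); last by ring.
  by rewrite sqrtr1 expr1n invr1; ring.
rewrite (mean_cst sigmaP) -psi0 -psi10; apply: eq_mean => y /usphereP y1.
rewrite /poisson /distN /k /Q sqr_enorm /enorm dotv_sub y1 -/a.
have -> : 1 - 2 * 1 * dotv x y + 1 ^+ 2 * a = a - 2 * dotv x y + 1 by ring.
by rewrite expr1n mul1r.
Qed.

End PoissonTotal.

(** * Wallis integrals *)

Section Primitive.
Context {R : realType}.
Implicit Types (f F : R -> R) (a b x t : R).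

Notation mu := (@lebesgue_measure R).

(** The base point [-2] lies outside [[-1, 1]], so that [prim f] is differentiable
    up to and including the end points. *)
Definition prim f x : R := \int[mu]_(t in `[-2, x]) f t.

Lemma der_prim f x : continuous f -> -2 < x < 2 -> is_derive x 1 (prim f) (f x).
Proof.
move=> cf /andP[x2 x2'].
have fi : mu.-integrable `[-2, 2] (EFin \o f).
  apply: continuous_compact_integrable; first exact: segment_compact.
  by apply: continuous_subspaceT => y; exact: cf.
have [d1 d2] := continuous_FTC1_closed x2' fi x2 (cf x).
by constructor; [exact: d1|rewrite -d2 derive1E].
Qed.

Lemma le_of_der (G g : R -> R) a b : a <= b ->
  (forall x, a < x < b -> is_derive x 1 G (g x)) ->
  (forall x, a < x < b -> 0 <= g x) ->
  (forall x, a <= x <= b -> {for x, continuous G}) -> G a <= G b.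
Proof.
move=> ab dG g0 cG.
have [||c] := @MVT_segment _ G (fun x => Num.max 0 (g x)) a b ab.
- move=> x; rewrite in_itv/= => xab.
  by rewrite max_r; [exact: dG|exact: g0].
- apply: continuous_in_subspaceT => x /[!inE]; rewrite /= in_itv/=; exact: cG.
move=> _ GE; rewrite -subr_ge0 GE mulr_ge0 ?subr_ge0//.
by rewrite le_max lexx.
Qed.

Lemma eq_of_der (G : R -> R) a b : a <= b ->
  (forall x, a < x < b -> is_derive x 1 G 0) ->
  (forall x, a <= x <= b -> {for x, continuous G}) -> G a = G b.
Proof.
move=> ab dG cG; apply/eqP; rewrite eq_le; apply/andP; split.
  exact: (le_of_der ab dG).
rewrite -lerN2; apply: (@le_of_der (fun x => - G x) (fun=> - 0) a b ab).
- by move=> x xab; apply: derN; exact: dG.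
- by move=> x _; rewrite oppr0.
- by move=> x xab; apply: contN; exact: cG.
Qed.

End Primitive.

Section Wallis.
Context {R : realType}.
Implicit Types (t : R) (k m : nat).

(** It vanishes outside [[-1, 1]], because the square root of a negative number
    is [0]. *)
Definition semicirc t : R := Num.sqrt (1 - t ^+ 2).
Local Notation v := semicirc.

Lemma semicirc_continuous : continuous v.
Proof.
move=> t; apply: (@cont_comp _ _ Num.sqrt (fun t => 1 - t ^+ 2)).
  exact: sqrt_continuous.
apply: contB; first exact: cont_cst.
by apply: contX; exact: cvg_id.
Qed.

Lemma semicircX_continuous k : continuous (fun t => v t ^+ k).
Proof. by move=> t; apply: contX; exact: semicirc_continuous. Qed.

Lemma itv11_sqr t : -1 < t < 1 -> 0 < 1 - t ^+ 2.
Proof. by move=> /andP[? ?]; rewrite -[_ - _]/(1 - t ^+ 2); nra. Qed.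

Lemma semicirc_gt0 t : -1 < t < 1 -> 0 < v t.
Proof. by move=> t1; rewrite sqrtr_gt0 itv11_sqr. Qed.

Lemma semicirc_ge0 t : 0 <= v t. Proof. exact: sqrtr_ge0. Qed.

Lemma semicirc1 : v 1 = 0.
Proof. by rewrite /v expr1n subrr sqrtr0. Qed.

Lemma semicircN1 : v (-1) = 0.
Proof. by rewrite /v sqrrN expr1n subrr sqrtr0. Qed.

Lemma sqr_semicirc t : -1 < t < 1 -> v t ^+ 2 = 1 - t ^+ 2.
Proof. by move=> t1; rewrite sqr_sqrtr// ltW// itv11_sqr. Qed.

Lemma der_semicircX m t : -1 < t < 1 ->
  is_derive t 1 (fun t => v t ^+ m.+2) (- m.+2%:R * t * v t ^+ m).
Proof.
move=> t1; have v0 := semicirc_gt0 t1.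
have d := derB (der_cst 1 t) (derX 2 (der_id t)).
apply: der_eq (derX m.+2 (der_sqrt d (itv11_sqr t1))) _.
rewrite -/(v t) /= exprS.
by field; rewrite gt_eqF.
Qed.

Lemma der_semicircXN k t : -1 < t < 1 ->
  is_derive t 1 (fun t => v t ^- k) (k%:R * t * v t ^- k.+2).
Proof.
move=> t1.
have d := derB (der_cst 1 t) (derX 2 (der_id t)).
apply: der_eq (der_sqrtXN k d (itv11_sqr t1)) _.
rewrite -/(v t) /=.
by field; rewrite expf_neq0// gt_eqF// semicirc_gt0.
Qed.

Lemma itv11_22 t : -1 <= t <= 1 -> -2 < t < 2.
Proof. by move=> /andP[? ?]; apply/andP; split; lra. Qed.

Lemma itv11W t : -1 < t < 1 -> -1 <= t <= 1.
Proof. by move=> /andP[? ?]; rewrite !ltW. Qed.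

Lemma prim_continuous (f : R -> R) t : continuous f -> -1 <= t <= 1 ->
  {for t, continuous (prim f)}.
Proof. by move=> cf t1; exact: der_continuous (der_prim cf (itv11_22 t1)). Qed.

Definition wallis k : R :=
  prim (fun t => v t ^+ k) 1 - prim (fun t => v t ^+ k) (-1).

Lemma wallis0 : wallis 0 = 2.
Proof.
pose G t := prim (fun t => v t ^+ 0) t - t.
have c := @semicircX_continuous 0.
have : G (-1) = G 1.
  apply: eq_of_der; first by lra.
    move=> t t1; apply: der_eq (derB (der_prim c (itv11_22 (itv11W t1))) (der_id t)) _.
    by rewrite expr0 subrr.
  by move=> t t1; apply: contB; [exact: prim_continuous|exact: cvg_id].
by rewrite /G /wallis; lra.
Qed.

(** [t * (1 - t^2)^(m/2+1)] vanishes at both ends of [[-1, 1]]. *)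
Lemma wallisSS m : m.+3%:R * wallis m.+2 = m.+2%:R * wallis m.
Proof.
pose G t := m.+3%:R * prim (fun t => v t ^+ m.+2) t -
  m.+2%:R * prim (fun t => v t ^+ m) t - t * v t ^+ m.+2.
have c2 := @semicircX_continuous m.+2.
have c0 := @semicircX_continuous m.
have : G (-1) = G 1.
  apply: eq_of_der; first by lra.
    move=> t t1; have t2 := itv11_22 (itv11W t1).
    apply: der_eq (derB (derB (derZ _ (der_prim c2 t2)) (derZ _ (der_prim c0 t2)))
      (derM (der_id t) (der_semicircX m t1))) _.
    rewrite (_ : v t ^+ m.+2 = v t ^+ 2 * v t ^+ m); last by rewrite -exprD.
    by rewrite sqr_semicirc// -[m.+3]addn1 natrD; ring.
  move=> t t1; apply: contB; [apply: contB|]; apply: contM; try exact: cont_cst.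
  - exact: prim_continuous.
  - exact: prim_continuous.
  - exact: cvg_id.
  - exact: semicircX_continuous.
rewrite /G semicirc1 semicircN1 !expr0n /= !mulr0 !subr0 /wallis; lra.
Qed.

(** The integral of [sqrt (1 - t^2) <= 1 - t^2 / 2 - t^4 / 8]; the coarser bound
    without the last term would be too large for [wallis_lt] at [m = 0]. *)
Lemma wallis1_le : wallis 1 <= 97 / 60.
Proof.
pose G t := t - t ^+ 3 / 6 - t ^+ 5 / 40 - prim (fun t => v t ^+ 1) t.
have c := @semicircX_continuous 1.
have : G (-1) <= G 1.
  apply: (@le_of_der _ G (fun t => 1 - t ^+ 2 / 2 - t ^+ 4 / 8 - v t ^+ 1)).
  - by lra.
  - move=> t t1; have t2 := itv11_22 (itv11W t1).
    apply: der_eq (derB (derB (derB (der_id t) (derM (derX 3 (der_id t)) (der_cst _ t)))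
       (derM (derX 5 (der_id t)) (der_cst _ t))) (der_prim c t2)) _.
    by rewrite /=; field.
  - move=> t t1; rewrite subr_ge0 expr1.
    have /andP[t1' t1''] := t1.
    have t20 := sqr_ge0 t.
    have t21 : t ^+ 2 < 1 by have := itv11_sqr t1; lra.
    have p0 : 0 <= 1 - t ^+ 2 / 2 - t ^+ 4 / 8.
      by rewrite (exprM t 2 2) ; move: (t ^+ 2) t20 t21 => u ? ?; nra.
    rewrite -(@ler_pXn2r _ 2)// ?nnegrE ?semicirc_ge0// sqr_semicirc//.
    rewrite (exprM t 2 2) -subr_ge0; move: (t ^+ 2) t20 => u u0.
    have -> : (1 - u / 2 - u ^+ 2 / 8) ^+ 2 - (1 - u) = u ^+ 3 / 8 + u ^+ 4 / 64 by field.
    by rewrite addr_ge0// divr_ge0// exprn_ge0.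
  - move=> t t1; apply: contB; last exact: prim_continuous.
    by repeat first [apply: contB|apply: contM|apply: contX|exact: cont_cst|exact: cvg_id].
rewrite /G /wallis; lra.
Qed.

Lemma wallis1_gt0 : 0 < wallis 1.
Proof.
pose G t := prim (fun t => v t ^+ 1) t - (t - t ^+ 3 / 3).
have c := @semicircX_continuous 1.
have : G (-1) <= G 1.
  apply: (@le_of_der _ G (fun t => v t ^+ 1 - (1 - t ^+ 2))).
  - by lra.
  - move=> t t1; have t2 := itv11_22 (itv11W t1).
    apply: der_eq (derB (der_prim c t2)
      (derB (der_id t) (derM (derX 3 (der_id t)) (der_cst _ t)))) _.
    by rewrite /=; field.
  - move=> t t1; rewrite subr_ge0 expr1 -sqr_semicirc//.
    have v1 : v t <= 1 by rewrite -(sqrtr1 R) ler_wsqrtr// gerBl sqr_ge0.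
    by rewrite expr2 ler_piMr// semicirc_ge0.
  - move=> t t1; apply: contB; first exact: prim_continuous.
    by repeat first [apply: contB|apply: contM|apply: contX|exact: cont_cst|exact: cvg_id].
rewrite /G /wallis; lra.
Qed.

Lemma nat_ind2 (P : nat -> Prop) : P 0%N -> P 1%N ->
  (forall m, P m -> P m.+2) -> forall m, P m.
Proof.
move=> P0 P1 PS m; suff : P m /\ P m.+1 by case.
by elim: m => [|m [Pm Pm1]]; split => //; exact: PS.
Qed.

Lemma wallis_gt0 k : 0 < wallis k.
Proof.
elim/nat_ind2: k => [||m IH]; rewrite ?wallis0// ?wallis1_gt0//.
by rewrite -(pmulr_rgt0 _ (ltr0Sn R m.+2)) wallisSS mulr_gt0.
Qed.

(** By [wallisSS], passing from [m] to [m + 2] multiplies the left-hand side by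
    [((m+5)/(m+4))^2], and [(m+5)^2 (m+3) < (m+4)^2 (m+5)]. *)
Lemma wallis_lt m : m.+4%:R ^+ 2 * wallis m.+3 ^+ 2 < 8 * m.+3%:R.
Proof.
elim/nat_ind2: m => [||m IH].
- have := wallisSS 1; have := wallis1_le; have := wallis1_gt0.
  move: (wallis 1) (wallis 3) => a b a0 a1 ab.
  rewrite -exprMn ab exprMn; nra.
- have := wallisSS 2; have := wallisSS 0; rewrite wallis0 => a b.
  have -> : wallis 4 = 16 / 15 by lra.
  lra.
- rewrite -exprMn wallisSS exprMn.
  have w0 := sqr_ge0 (wallis m.+3).
  have e4 : m.+4%:R = m.+3%:R + 1 :> R by rewrite natr1.
  have e5 : m.+2.+3%:R = m.+3%:R + 2 :> R by rewrite -natrD addn2.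
  move: IH; rewrite e4 e5.
  have m0 : 0 < m.+3%:R :> R by rewrite ltr0Sn.
  move: (m.+3%:R) (wallis m.+3 ^+ 2) m0 w0 => a w a0 w0 IH.
  nra.
Qed.

End Wallis.

(** * Volumes of balls *)

Section BallVolume.
Context {R : realType}.

Notation mu := (@lebesgue_measure R).

Definition ball_const (k : nat) : R := \prod_(i < k) wallis i.

Lemma dotv_row_mx (k : nat) (t : R) (u : 'rV[R]_k) :
  @dotv R k.+1 (row_mx (t%:M : 'rV_1) u) (row_mx (t%:M : 'rV_1) u) =
  t ^+ 2 + dotv u u.
Proof.
rewrite /dotv big_ord_recl; congr (_ + _).
  have -> : ord0 = lshift k (ord0 : 'I_1) by exact/val_inj.
  by rewrite (row_mxEl (t%:M : 'rV_1) u) mxE eqxx mulr1n expr2.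
apply: eq_bigr => i _.
have -> : lift ord0 i = rshift 1 i by exact/val_inj.
by rewrite (row_mxEr (t%:M : 'rV_1) u).
Qed.

Lemma sqrtBsqr_continuous (a : R) : continuous (fun t : R => Num.sqrt (a - t ^+ 2) : R).
Proof.
move=> t; apply: (@cont_comp _ _ Num.sqrt (fun t : R => a - t ^+ 2 : R)).
  exact: sqrt_continuous.
by apply: contB; [exact: cont_cst|apply: contX; exact: cvg_id].
Qed.

(** The primitive of the integrand, for [r = sqrt a], is
    [r^(k+1) * prim (semicirc^k) (t / r)]. *)
Lemma integral_semicirc (k : nat) (a : R) : 0 < a ->
  (\int[mu]_(t in `](- Num.sqrt a)%R, (Num.sqrt a)%R[) (Num.sqrt (a - t ^+ 2) ^+ k)%:E =
   (Num.sqrt a ^+ k.+1 * wallis k)%:E)%E.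
Proof.
move=> a0; have r0 : 0 < Num.sqrt a by rewrite sqrtr_gt0.
have r2 : Num.sqrt a ^+ 2 = a by rewrite sqr_sqrtr// ltW.
move: r2 r0; move: (Num.sqrt a) => r <- r0 {a a0}.
have cf : continuous (fun t : R => Num.sqrt (r ^+ 2 - t ^+ 2) ^+ k).
  move=> t; apply: (@contX R R (fun t => Num.sqrt (r ^+ 2 - t ^+ 2))).
  exact: sqrtBsqr_continuous.
have mf (D : set R) : measurable D ->
    measurable_fun D (fun t => (Num.sqrt (r ^+ 2 - t ^+ 2) ^+ k)%:E).
  move=> mD; apply/measurable_EFinP; apply: measurable_funTS.
  exact: continuous_measurable_fun.
rewrite integral_itv_obnd_cbnd; last exact: mf.
rewrite integral_itv_bndo_bndc; last exact: mf.
pose F (t : R) := r ^+ k.+1 * prim (fun t => semicirc t ^+ k) (t / r).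
have dF (t : R) : - r <= t <= r ->
    is_derive t 1 F (Num.sqrt (r ^+ 2 - t ^+ 2) ^+ k).
  move=> /andP[t1 t2].
  have tr : -1 <= t / r <= 1 by rewrite ler_pdivlMr// ler_pdivrMr// mulN1r mul1r t1.
  have d := der_prim (@semicircX_continuous R k) (itv11_22 tr).
  have d1 := derM (der_id t) (der_cst r^-1 t).
  have d2 := @der_comp _ _ (fun t => t / r) t _ _ d d1.
  apply: der_eq (derZ (r ^+ k.+1) d2) _.
  rewrite /semicirc (_ : r ^+ 2 - t ^+ 2 = r ^+ 2 * (1 - (t / r) ^+ 2)); last first.
    by field; rewrite gt_eqF.
  rewrite sqrtrM ?sqr_ge0// sqrtr_sqr gtr0_norm//.
  move: (Num.sqrt _) => w; rewrite exprS exprMn.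
  by field; rewrite gt_eqF.
have rr : - r < r by lra.
rewrite (@continuous_FTC2 _ _ F (- r) r rr).
- rewrite /F /wallis mulNr divff ?gt_eqF// -EFinB; congr (_%:E); ring.
- by apply: continuous_subspaceT => y; exact: cf.
- split.
  + move=> t; rewrite in_itv/= => /andP[t1 t2].
    have t12 : - r <= t <= r by rewrite !ltW.
    by case: (dF t t12).
  + apply: cvg_at_right_filter; apply: der_continuous (dF _ _).
    by rewrite lexx ltW.
  + apply: cvg_at_left_filter; apply: der_continuous (dF _ _).
    by rewrite lexx ltW.
- move=> t; rewrite in_itv/= => /andP[t1 t2].
  have t12 : - r <= t <= r by rewrite !ltW.
  by rewrite derive1E; case: (dF t t12).
Qed.

(** The section at height [t] of the ball of squared radius [a] is the ball of
    squared radius [a - t^2].  Without the case distinction the formula would fail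
    for [k = 0] and [a <= 0]. *)
Lemma lebesgue_ball (k : nat) (a : R) :
  lebesgue_rV [set u : 'rV[R]_k | dotv u u < a] =
  (if 0 < a then Num.sqrt a ^+ k * ball_const k else 0)%:E.
Proof.
elim: k a => [|k IH] a.
  rewrite [LHS]/= indicE expr0 /ball_const big_ord0 mulr1.
  by have [a0|a0] := ltP 0 a; [rewrite mem_set|rewrite memNset]; rewrite //= dotv0l// ltNge a0.
have [a0|a0] := ltP 0 a; last first.
  rewrite /=; under eq_integral => t _.
    rewrite (_ : [set u | _] = [set u : 'rV[R]_k | dotv u u < a - t ^+ 2]).
      rewrite IH ifN; first over.
      by rewrite -leNgt subr_le0 (le_trans a0)// sqr_ge0.
    by apply/seteqP; split => u; rewrite /= dotv_row_mx ltrBrDl.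
  by rewrite integral0.
rewrite /=; transitivity (\int[mu]_t (((fun t : R =>
    (Num.sqrt (a - t ^+ 2) ^+ k * ball_const k)%:E) \_
    `](- Num.sqrt a)%R, (Num.sqrt a)%R[) t))%E.
  apply: eq_integral => t _.
  rewrite (_ : [set u | _] = [set u : 'rV[R]_k | dotv u u < a - t ^+ 2]); last first.
    by apply/seteqP; split => u; rewrite /= dotv_row_mx ltrBrDl.
  have tE : (t \in `]- Num.sqrt a, Num.sqrt a[) = (0 < a - t ^+ 2).
    rewrite in_itv/= -ltr_norml -sqrtr_sqr ltr_sqrt// subr_gt0//.
  by rewrite IH patchE mem_setE tE; case: ifP.
rewrite -integral_mkcond.
under eq_integral do rewrite mulrC EFinM.
rewrite ge0_integralZl//.
- rewrite integral_semicirc// -EFinM /ball_const big_ord_recr/=; congr (_%:E); ring.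
- apply/measurable_EFinP; apply: measurable_funTS.
  apply: continuous_measurable_fun => t.
  apply: (@contX R R (fun t => Num.sqrt (a - t ^+ 2))).
  exact: sqrtBsqr_continuous.
- by rewrite lee_fin prodr_ge0// => i _; rewrite ltW// wallis_gt0.
Qed.

Lemma omega_ratio (k : nat) : omega k / omega k.+1 = (wallis k)^-1 :> R.
Proof.
have omegaE m : omega m = ball_const m :> R.
  rewrite /omega (_ : @uball R m = [set u | dotv u u < 1]).
    by rewrite lebesgue_ball ltr01 sqrtr1 expr1n mul1r.
  by apply/seteqP; split => u /uballP.
rewrite !omegaE /ball_const big_ord_recr/=.
have w0 : wallis k != 0 :> R by rewrite gt_eqF// wallis_gt0.
have b0 : \prod_(i < k) wallis i != 0 :> R.
  by apply/prodf_neq0 => i _; rewrite gt_eqF// wallis_gt0.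
by field; rewrite w0 b0.
Qed.

End BallVolume.

(** * A bounded solution of Stein's equation *)

Section SteinSolution.
Context {R : realType} (m : nat).
Local Notation v := (@semicirc R).
Implicit Types (t : R).

(** The value for which [1 - C |t|] has integral [0] against [v^m] on [[-1, 1]]
    (see [F1]). *)
Let C : R := m.+2%:R * wallis m / 2.

Let f t : R := (1 - C * `|t|) * v t ^+ m.

Let cf : continuous f.
Proof.
move=> t; apply: (@contM R R (fun t => 1 - C * `|t|) (fun t => v t ^+ m)).
  2: exact: semicircX_continuous.
apply: contB; first exact: cont_cst.
apply: (@contM R R (fun=> C) (fun t => `|t| : R)); first exact: cont_cst.
exact: norm_continuous.
Qed.

Let F t : R := prim f t - prim f (-1).

Let dF t : -1 <= t <= 1 -> is_derive t 1 F (f t).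
Proof.
move=> t1; apply: der_eq (derB (der_prim cf (itv11_22 t1)) (der_cst _ t)) _.
by rewrite subr0.
Qed.

Let cF t : -1 <= t <= 1 -> {for t, continuous F}.
Proof. by move=> t1; exact: der_continuous (dF t1). Qed.

Let semicirc0 : v 0 = 1.
Proof. by rewrite /semicirc expr0n subr0 sqrtr1. Qed.

(** On either half of [[-1, 1]], [|t| v^m] is the derivative of a multiple of
    [v^(m+2)]. *)
Let F1 : F 1 = 0.
Proof.
have m0 : m.+2%:R != 0 :> R by rewrite pnatr_eq0.
have c := @semicircX_continuous R m.
(* G 1 is constant on [0, 1] and G (-1) on [-1, 0]. *)
pose G (b t : R) : R :=
  prim f t - prim (fun t => v t ^+ m) t - b * C * v t ^+ m.+2 / m.+2%:R.
have d (b : R) t : -1 < t < 1 -> is_derive t 1 (G b)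
    (C * (b * t - `|t|) * v t ^+ m).
  move=> t1; have t2 := itv11_22 (itv11W t1).
  apply: der_eq (derB (derB (der_prim cf t2) (der_prim c t2))
    (derM (derZ (b * C) (der_semicircX m t1)) (der_cst _ t))) _.
  by rewrite /f; field.
have cG (b : R) t : -1 <= t <= 1 -> {for t, continuous (G b)}.
  move=> t1; apply: contB; first by apply: contB; exact: prim_continuous.
  by apply: contM; [apply: contM; [exact: cont_cst|exact: semicircX_continuous]
                   |exact: cont_cst].
have : G 1 0 = G 1 1.
  apply: (eq_of_der ler01).
    move=> t /andP[t0 t1].
    have tt : -1 < t < 1 by rewrite t1 (lt_trans _ t0)// oppr_lt0.
    by apply: der_eq (d 1 t tt) _; rewrite gtr0_norm// mul1r subrr mulr0 mul0r.
  by move=> t /andP[t0 t1]; apply: cG; rewrite t1 (le_trans _ t0)// oppr_le0.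
have : G (-1) (-1) = G (-1) 0.
  apply: eq_of_der; first by rewrite oppr_le0.
    move=> t /andP[t1 t0].
    have tt : -1 < t < 1 by rewrite t1 (lt_trans t0).
    by apply: der_eq (d (-1) t tt) _; rewrite ltr0_norm// mulN1r subrr mulr0 mul0r.
  by move=> t /andP[t1 t0]; apply: cG; rewrite t1 (le_trans t0).
rewrite /G semicirc1 semicircN1 semicirc0 expr1n expr0n /= !mulr0 !mul0r.
rewrite !mulr1 mul1r mulN1r mulNr.
have -> : C / m.+2%:R = wallis m / 2 by rewrite /C; field.
by rewrite /F /wallis; lra.
Qed.

(** Equality holds at [-1], and the difference has the derivative
    [(1 + t) v^m].  In [F_right] equality holds at [1]. *)
Let F_left t : -1 <= t <= 0 -> (1 - C) * v t ^+ m.+2 / m.+2%:R <= F t.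
Proof.
move=> /andP[t1 t0]; have m0 : m.+2%:R != 0 :> R by rewrite pnatr_eq0.
have : F (-1) - (1 - C) * v (-1) ^+ m.+2 / m.+2%:R <=
       F t - (1 - C) * v t ^+ m.+2 / m.+2%:R.
  apply: (@le_of_der _ (fun t => F t - (1 - C) * v t ^+ m.+2 / m.+2%:R)
                       (fun t => (1 + t) * v t ^+ m)) => //.
  - move=> s /andP[s1 st].
    have s0 : s < 0 by rewrite (lt_le_trans st).
    have ss : -1 < s < 1 by rewrite s1 (lt_trans s0).
    apply: der_eq (derB (dF (itv11W ss))
      (derM (derZ (1 - C) (der_semicircX m ss)) (der_cst _ s))) _.
    by rewrite /f ltr0_norm//; field.
  - move=> s /andP[s1 st]; rewrite mulr_ge0 ?exprn_ge0 ?semicirc_ge0//; lra.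
  - move=> s /andP[s1 st]; apply: contB; first by apply: cF; rewrite s1/=; lra.
    by apply: contM; [apply: contM; [exact: cont_cst|exact: semicircX_continuous]
                     |exact: cont_cst].
by rewrite /F subrr semicircN1 expr0n /= mulr0 mul0r subrr subr_ge0.
Qed.

Let F_right t : 0 <= t <= 1 -> F t <= - ((1 - C) * v t ^+ m.+2 / m.+2%:R).
Proof.
move=> /andP[t0 t1]; have m0 : m.+2%:R != 0 :> R by rewrite pnatr_eq0.
have : F t + (1 - C) * v t ^+ m.+2 / m.+2%:R <=
       F 1 + (1 - C) * v 1 ^+ m.+2 / m.+2%:R.
  apply: (@le_of_der _ (fun t => F t + (1 - C) * v t ^+ m.+2 / m.+2%:R)
                       (fun t => (1 - t) * v t ^+ m)) => //.
  - move=> s /andP[ts s1].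
    have s0 : 0 < s by rewrite (le_lt_trans t0).
    have ss : -1 < s < 1 by rewrite s1 (lt_trans _ s0)// oppr_lt0.
    apply: der_eq (derD (dF (itv11W ss))
      (derM (derZ (1 - C) (der_semicircX m ss)) (der_cst _ s))) _.
    by rewrite /f gtr0_norm//; field.
  - move=> s /andP[ts s1]; rewrite mulr_ge0 ?exprn_ge0 ?semicirc_ge0//; lra.
  - move=> s /andP[ts s1]; apply: contD; first by apply: cF; rewrite s1 andbT; lra.
    by apply: contM; [apply: contM; [exact: cont_cst|exact: semicircX_continuous]
                     |exact: cont_cst].
by rewrite F1 semicirc1 expr0n /= mulr0 mul0r addr0 -lerBrDr sub0r.
Qed.

(** With the integrating factor [v^(m+2)], the equation says that
    [phi * v^(m+2)] is a primitive [F] of [(1 - C |t|) v^m]; the choice of [C] lets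
    [F] vanish at both ends.  The bound on [dphi], which the bounds on [F] give,
    controls the error made by staying away from the poles. *)
Lemma stein_solution : exists phi dphi : R -> R, forall t, -1 < t < 1 ->
  [/\ is_derive t 1 phi (dphi t), {for t, continuous dphi},
      (1 - t ^+ 2) * dphi t - m.+2%:R * t * phi t =
        1 - m.+2%:R * wallis m / 2 * `|t| &
      dphi t <= 1].
Proof.
pose phi t := F t * v t ^- m.+2.
pose dphi t := f t * v t ^- m.+2 + F t * (m.+2%:R * t * v t ^- m.+4).
exists phi, dphi => t t1; have v0 := semicirc_gt0 t1.
have v2 := sqr_semicirc t1; have t2 := itv11_sqr t1.
have eqn : (1 - t ^+ 2) * dphi t - m.+2%:R * t * phi t = 1 - C * `|t|.
  rewrite /dphi /phi /f -v2 !exprS; field.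
  by rewrite expf_neq0 gt_eqF.
split => //.
- exact: derM (dF (itv11W t1)) (der_semicircXN m.+2 t1).
- have cV k : {for t, continuous (fun t => v t ^- k)}.
    apply: contV; first by rewrite expf_neq0// gt_eqF.
    exact: semicircX_continuous.
  apply: contD; first by apply: contM; [exact: cf|exact: cV].
  apply: contM; first exact: cF (itv11W t1).
  by apply: contM; [apply: contM; [exact: cont_cst|exact: cvg_id]|exact: cV].
rewrite -(ler_pM2l t2) mulr1.
have -> : (1 - t ^+ 2) * dphi t = 1 - C * `|t| + m.+2%:R * t * phi t.
  by rewrite -eqn subrK.
have phiE : m.+2%:R * t * phi t = t * (m.+2%:R * F t / v t ^+ m.+2).
  by rewrite /phi; ring.
have vm0 : 0 < v t ^+ m.+2 by rewrite exprn_gt0.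
have m0 : 0 < m.+2%:R :> R by rewrite ltr0Sn.
have /andP[tN1 t1'] := t1.
rewrite phiE; have [t0|t0] := leP 0 t.
  have t01 : 0 <= t <= 1 by rewrite t0 ltW.
  have : m.+2%:R * F t / v t ^+ m.+2 <= - (1 - C).
    rewrite ler_pdivrMr// mulrC -ler_pdivlMr// mulNr mulNr.
    exact: F_right.
  move: (_ / _) => r rC; rewrite ger0_norm//; nra.
have t01 : -1 <= t <= 0 by rewrite !ltW.
have : 1 - C <= m.+2%:R * F t / v t ^+ m.+2.
  by rewrite ler_pdivlMr// -ler_pdivrMl// [leLHS]mulrC; exact: F_left.
move: (_ / _) => r rC; rewrite ltr0_norm//; nra.
Qed.

End SteinSolution.

(** * The law of one coordinate *)

Section CoordinateLaw.
Context {R : realType} {n : nat}.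
Context (sigma : {measure set (borel_rV R n) -> \bar R}).
Context (sigmaP : normalized_sphere_measure sigma).
Context (i j : 'I_n) (ij : i != j).
Implicit Types (y : 'rV[R]_n) (t s : R).

Notation S := (@usphere R n).
Notation E f := (Rintegral sigma (S : set (borel_rV R n)) f).

Lemma entry_sqr_le1 y : S y -> y 0 i ^+ 2 <= 1.
Proof.
move=> /usphereP <-; rewrite /dotv (bigD1 i)//= -expr2 lerDl.
by apply: sumr_ge0 => k _; rewrite -expr2 sqr_ge0.
Qed.

Lemma entry_itv y : S y -> -1 <= y 0 i <= 1.
Proof.
move=> /entry_sqr_le1 yi; rewrite -ler_norml -(@expr_le1 _ 2)//.
by rewrite -normrX ger0_norm ?sqr_ge0.
Qed.

(** The rotation by the angle [pi] changes the sign of the [i]-th coordinate. *)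
Lemma mean_entry_opp (h : R -> R) :
  bounded_measurable (fun y => h (y 0 i)) ->
  E (fun y => h (y 0 i)) = E (fun y => h (- y 0 i)).
Proof.
move=> bh; rewrite -(mean_rotation sigmaP (plane_rotP pi ij) bh).
apply: eq_mean => y _; congr h.
by rewrite plane_rotE !mxE !eqxx (negbTE ij) sinpi cospi /=; ring.
Qed.

(** Stein's identity for the vector [l e_i]; for [l < 1] the function [phi] is
    evaluated at a distance from [-1] and [1]. *)
Lemma stein_entry (l : R) (phi dphi : R -> R) : 0 <= l ->
  (forall s, `|s| <= l -> is_derive s 1 phi (dphi s)) ->
  (forall s, `|s| <= l -> {for s, continuous dphi}) ->
  E (fun y => l ^+ 2 * (1 - y 0 i ^+ 2) * dphi (l * y 0 i) -
              (n%:R - 1) * (l * y 0 i) * phi (l * y 0 i)) = 0.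
Proof.
move=> l0 dp cdp; pose x : 'rV[R]_n := l *: delta_mx 0 i.
have xx : dotv x x = l ^+ 2.
  by rewrite dotvZl dotvZr dotv_delta mxE !eqxx /=; ring.
have xl : enorm x = l by rewrite /enorm xx sqrtr_sqr ger0_norm.
have xy y : dotv x y = l * y 0 i by rewrite dotvZl dotvC dotv_delta.
have := stein sigmaP (x := x) (phi := phi) (dphi := dphi); rewrite xl => st.
rewrite -[RHS](st dp cdp); apply: eq_mean => y _.
by rewrite xx xy; ring.
Qed.

Lemma bounded_measurable_entry (h : R -> R) :
  (forall t, -1 <= t <= 1 -> {for t, continuous h}) ->
  bounded_measurable (fun y => h (y 0 i)).
Proof.
move=> ch; apply: bounded_measurable_continuous => y Sy.
by apply: cont_comp; [exact: ch (entry_itv Sy)|exact: continuous_entry].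
Qed.

Lemma cont_norm t : {for t, continuous (fun t : R => `|t| : R)}.
Proof. exact: norm_continuous. Qed.

Lemma bounded_measurable_abs_entry : bounded_measurable (fun y => `|y 0 i|).
Proof. by apply: (bounded_measurable_entry (h := fun t => `|t|)) => t _; exact: cont_norm. Qed.

(** For the solution [phi] of Stein's equation and [l < 1], the integrand of
    [stein_entry] is at least [l^2 - C l |y_i|], which gives [l <= C E |y_i|]. *)
Lemma abs_moment_ge (m : nat) : n = m.+3 ->
  1 <= m.+2%:R * wallis m / 2 * E (fun y => `|y 0 i|).
Proof.
move=> nm; have [phi [dphi sol]] := @stein_solution R m.
set C := _ / 2; set M := E _.
have nR : n%:R - 1 = m.+2%:R :> R by rewrite nm -[m.+3]addn1 natrD addrK.
have bM := bounded_measurable_abs_entry.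
(* phi is controlled only in the interior of [-1, 1]; let l tend to 1. *)
suff step l : 0 < l -> l < 1 -> l <= C * M.
  rewrite leNgt; apply/negP => CM1.
  have M0 : 0 <= C * M.
    apply: le_trans (step (1 / 2) _ _); rewrite ?divr_gt0//; lra.
  have := step ((C * M + 1) / 2); lra.
move=> l0 l1.
have lt1 s : `|s| <= l -> -1 < s < 1.
  by move=> sl; rewrite -ltr_norml (le_lt_trans sl).
have dp s : `|s| <= l -> is_derive s 1 phi (dphi s) by move=> /lt1/sol[].
have cp s : `|s| <= l -> {for s, continuous dphi} by move=> /lt1/sol[].
have ly y : S y -> `|l * y 0 i| <= l.
  move=> /entry_itv; rewrite -ler_norml => y1.
  by rewrite normrM (gtr0_norm l0) ler_piMr// ltW.
have cly y : {for y, continuous (fun y : 'rV[R]_n => l * y 0 i)}.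
  by apply: contM; [exact: cont_cst|exact: continuous_entry].
have bD : bounded_measurable (fun y => l ^+ 2 * (1 - y 0 i ^+ 2) * dphi (l * y 0 i) -
              (n%:R - 1) * (l * y 0 i) * phi (l * y 0 i)).
  apply: bounded_measurable_continuous => y Sy; apply: contB; apply: contM.
  - apply: contM; first exact: cont_cst.
    by apply: contB; [exact: cont_cst|apply: contX; exact: continuous_entry].
  - by apply: cont_comp (cly y); exact: cp (ly y Sy).
  - by apply: contM; [exact: cont_cst|exact: cly].
  - by apply: cont_comp (cly y); exact: der_continuous (dp _ (ly y Sy)).
have bL : bounded_measurable (fun y => l ^+ 2 - C * l * `|y 0 i|).
  apply: bounded_measurableD; first exact: bounded_measurable_cst.
  apply: bounded_measurableN; apply: bounded_measurableM => //.
  exact: bounded_measurable_cst.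
have := le_mean sigmaP bL bD.
rewrite (stein_entry (ltW l0) dp cp) => h.
have : E (fun y => l ^+ 2 - C * l * `|y 0 i|) = l ^+ 2 - C * l * M.
  rewrite (meanB sigmaP) ?(mean_cst sigmaP) ?(meanZ sigmaP)//.
    exact: bounded_measurable_cst.
  by apply: bounded_measurableM => //; exact: bounded_measurable_cst.
move=> EL; rewrite EL in h.
suff : l ^+ 2 - C * l * M <= 0.
  rewrite subr_le0 expr2 (mulrC C) -mulrA ler_pM2l//.
apply: h => y Sy.
have [_ _ eq1 le1] := sol _ (lt1 _ (ly y Sy)).
have l21 : 0 <= 1 - l ^+ 2 by rewrite subr_ge0 expr_le1// ltW.
move: eq1; rewrite normrM (gtr0_norm l0) -/C nR.
have := ler_wpM2l l21 le1; rewrite mulr1 exprMn.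
move: (phi _) (dphi _) => p d hd eq1.
have -> : l ^+ 2 * (1 - y 0 i ^+ 2) * d - m.+2%:R * (l * y 0 i) * p =
  ((1 - l ^+ 2 * y 0 i ^+ 2) * d - m.+2%:R * (l * y 0 i) * p) - (1 - l ^+ 2) * d.
  by ring.
by rewrite eq1; lra.
Qed.

Definition zone s y : R := (`|y 0 i| <= s)%R%:R.

Lemma bounded_measurable_zone s : bounded_measurable (zone s).
Proof.
have -> : zone s = \1_[set y : borel_rV R n | `|(y : 'rV[R]_n) 0 i| <= s].
  apply/funext => y; rewrite indicE /zone.
  by case: lerP => ys; [rewrite mem_set|rewrite memNset//=; apply/negP; rewrite -ltNge].
apply: bounded_measurable_indic.
rewrite -[X in measurable X]setCK; apply: measurableC.
apply: measurable_open_rV.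
rewrite (_ : ~` _ = (fun y : 'rV[R]_n => `|y 0 i|) @^-1` [set r | s < r]); last first.
  by apply/seteqP; split => y /=; rewrite ltNge => /negP.
apply: open_comp => [y _|]; last exact: open_gt.
by apply: cont_comp; [exact: cont_norm|exact: continuous_entry].
Qed.

(** Since [s - |t|] is [s] times the tent [g t = max 0 (1 - |t| / s)] where
    [|t| <= s], the term [s D - X] is [s] times the mean of [g].  Stein's identity
    for the primitive [phi] of [g] bounds this mean from below, because
    [t phi t >= |t| s / 2] for [|t| >= s]. *)
Lemma zone_mass_ge s : 0 < s <= 1 ->
  E (fun y => `|y 0 i| * zone s y) <=
  s * E (zone s) - (n%:R - 1) * s ^+ 2 / 2 *
    (E (fun y => `|y 0 i|) - E (fun y => `|y 0 i| * zone s y)).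
Proof.
move=> /andP[s0 s1].
pose M := E (fun y => `|y 0 i|); pose D := E (zone s).
pose X := E (fun y => `|y 0 i| * zone s y); rewrite -/M -/D -/X.
pose g t : R := Num.max 0 (1 - `|t| / s).
have cg : continuous g.
  move=> t; apply: (@continuous_max _ _ (fun=> 0) (fun t => 1 - `|t| / s)).
    exact: cst_continuous.
  apply: contB; first exact: cont_cst.
  by apply: contM; [exact: cont_norm|exact: cont_cst].
pose phi t : R := prim g t - prim g 0.
have dphi t : -1 <= t <= 1 -> is_derive t 1 phi (g t).
  move=> t1; apply: der_eq (derB (der_prim cg (itv11_22 t1)) (der_cst _ t)) _.
  by rewrite subr0.
have cphi t : -1 <= t <= 1 -> {for t, continuous phi}.
  by move=> t1; exact: der_continuous (dphi t t1).
have phi0 : phi 0 = 0 by rewrite /phi subrr.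
have g0 t : 0 <= g t by rewrite le_max lexx.
have mono a b : -1 <= a -> a <= b -> b <= 1 -> phi a <= phi b.
  move=> a1 ab b1; apply: (le_of_der ab (g := g)) => // t /andP[ta tb].
    by apply: dphi; rewrite (le_trans a1 (ltW ta)) (le_trans (ltW tb)).
  by apply: cphi; rewrite (le_trans a1 ta) (le_trans tb).
have phis : s / 2 <= phi s.
  have : phi 0 - (0 - 0 ^+ 2 / (2 * s)) <= phi s - (s - s ^+ 2 / (2 * s)).
    apply: (@le_of_der _ (fun t => phi t - (t - t ^+ 2 / (2 * s)))
              (fun t => g t - (1 - t / s))) => [|t /andP[t0 ts]|t /andP[t0 ts]|t /andP[t0 ts]].
    - exact: ltW.
    - have t1 : -1 <= t <= 1 by apply/andP; split; lra.
      apply: der_eq (derB (dphi t t1) (derB (der_id t)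
        (derM (derX 2 (der_id t)) (der_cst _ t)))) _.
      by rewrite /=; field; rewrite gt_eqF.
    - by rewrite subr_ge0 /g (gtr0_norm t0) le_max lexx orbT.
    - apply: contB; first by apply: cphi; apply/andP; split; lra.
      by apply: contB; [exact: cvg_id|apply: contM; [apply: contX; exact: cvg_id|exact: cont_cst]].
  rewrite phi0 expr0n /= mul0r !subr0.
  have -> : s ^+ 2 / (2 * s) = s / 2 by field; rewrite gt_eqF.
  lra.
have phiNs : phi (- s) <= - (s / 2).
  have : phi (- s) - (- s + (- s) ^+ 2 / (2 * s)) <= phi 0 - (0 + 0 ^+ 2 / (2 * s)).
    apply: (@le_of_der _ (fun t => phi t - (t + t ^+ 2 / (2 * s)))
              (fun t => g t - (1 + t / s))) => [|t /andP[ts t0]|t /andP[ts t0]|t /andP[ts t0]].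
    - by rewrite oppr_le0 ltW.
    - have t1 : -1 <= t <= 1 by apply/andP; split; lra.
      apply: der_eq (derB (dphi t t1) (derD (der_id t)
        (derM (derX 2 (der_id t)) (der_cst _ t)))) _.
      by rewrite /=; field; rewrite gt_eqF.
    - by rewrite subr_ge0 /g (ltr0_norm t0) mulNr opprK le_max lexx orbT.
    - apply: contB; first by apply: cphi; apply/andP; split; lra.
      by apply: contD; [exact: cvg_id|apply: contM; [apply: contX; exact: cvg_id|exact: cont_cst]].
  rewrite phi0 expr0n /= mul0r addr0 subr0 sqrrN.
  have -> : s ^+ 2 / (2 * s) = s / 2 by field; rewrite gt_eqF.
  lra.
have tphi t : -1 <= t <= 1 -> s / 2 * (`|t| - `|t| * (`|t| <= s)%R%:R) <= t * phi t.
  move=> /andP[t1 t1']; have [t0|t0] := leP 0 t.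
    rewrite (ger0_norm t0); have p0 : 0 <= phi t by rewrite -phi0 mono// lerN10.
    have [ts|st] := leP t s; first by rewrite mulr1 subrr mulr0 mulr_ge0.
    rewrite mulr0 subr0 mulrC ler_wpM2l// (le_trans phis)// mono//; lra.
  rewrite (ltr0_norm t0); have p0 : phi t <= 0.
    by rewrite -phi0 mono//; lra.
  have [ts|st] := leP (- t) s.
    by rewrite mulr1 subrr mulr0 mulr_le0// ltW.
  rewrite mulr0 subr0 mulrC -[leRHS]mulrNN ler_wpM2l//; first by rewrite oppr_ge0 ltW.
  rewrite lerNr (le_trans _ phiNs)// mono//; lra.
have bg := bounded_measurable_entry (fun t (_ : -1 <= t <= 1) => cg t).
have bzone := bounded_measurable_zone s.
have babs := bounded_measurable_abs_entry.
have bX : bounded_measurable (fun y => `|y 0 i| * zone s y) by exact: bounded_measurableM.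
have bc (c : R) (h : 'rV[R]_n -> R) : bounded_measurable h ->
    bounded_measurable (fun y => c * h y).
  by move=> bh; apply: bounded_measurableM => //; exact: bounded_measurable_cst.
have XE : X = s * D - s * E (fun y => g (y 0 i)).
  rewrite -!(meanZ sigmaP)// -(meanB sigmaP); try exact: bc.
  apply: eq_mean => y _; rewrite /zone /g.
  have [ys|ys] := leP `|y 0 i| s.
    rewrite max_r; first by rewrite /= !mulr1; field; rewrite gt_eqF.
    by rewrite subr_ge0 ler_pdivrMr// mul1r.
  rewrite max_l; first by rewrite /= !mulr0 subr0.
  by rewrite subr_le0 ler_pdivlMr// mul1r ltW.
have btphi : bounded_measurable (fun y => y 0 i * phi (y 0 i)).
  apply: bounded_measurableM; last exact: bounded_measurable_entry.
  by apply: (bounded_measurable_entry (h := id)) => t _; exact: cvg_id.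
have b1g : bounded_measurable (fun y => (1 - y 0 i ^+ 2) * g (y 0 i)).
  apply: bounded_measurableM => //.
  apply: (bounded_measurable_entry (h := fun t => 1 - t ^+ 2)) => t _.
  by apply: contB; [exact: cont_cst|apply: contX; exact: cvg_id].
have st : E (fun y => (1 - y 0 i ^+ 2) * g (y 0 i)) =
    (n%:R - 1) * E (fun y => y 0 i * phi (y 0 i)).
  have itv1 t : `|t| <= 1 -> -1 <= t <= 1 by rewrite ler_norml.
  have := stein_entry ler01 (fun t h => dphi t (itv1 t h)) (fun t _ => cg t).
  rewrite -(meanZ sigmaP)// => h0.
  apply/eqP; rewrite -subr_eq0 -(meanB sigmaP)//; last exact: bc.
  by rewrite -[X in _ == X]h0; apply/eqP; apply: eq_mean => y _; rewrite !mul1r expr1n mul1r mulrA.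
have le1 : E (fun y => (1 - y 0 i ^+ 2) * g (y 0 i)) <= E (fun y => g (y 0 i)).
  apply: (le_mean sigmaP) => // y Sy; rewrite ler_piMl//.
  by rewrite gerBl sqr_ge0.
have le2 : s / 2 * (M - X) <= E (fun y => y 0 i * phi (y 0 i)).
  rewrite -(meanB sigmaP)// -(meanZ sigmaP); last first.
    by apply: bounded_measurableD => //; exact: bounded_measurableN.
  apply: (le_mean sigmaP) => //.
    by apply: bc; apply: bounded_measurableD => //; exact: bounded_measurableN.
  by move=> y Sy; apply: tphi; exact: entry_itv.
have n1 : 0 <= n%:R - 1 :> R.
  by rewrite subr_ge0 ler1n; case: (n) i => [[]|].
have := ler_wpM2l n1 le2; rewrite -st => le3.
have := ler_wpM2l (ltW s0) (le_trans le3 le1).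
rewrite XE; lra.
Qed.

End CoordinateLaw.

(** * The harmonic function of a cap *)

Section ZonalSign.
Context {R : realType} {n : nat}.
Context (sigma : {measure set (borel_rV R n) -> \bar R}).
Context (sigmaP : normalized_sphere_measure sigma).
Context (i j : 'I_n) (ij : i != j).
Implicit Types (y : 'rV[R]_n) (t s : R).

Notation S := (@usphere R n).
Notation E f := (Rintegral sigma (S : set (borel_rV R n)) f).

(** A function of one coordinate has the mean of its even part. *)
Lemma mean_entry_sym (h k : R -> R) :
  bounded_measurable (fun y => h (y 0 i)) ->
  bounded_measurable (fun y => h (- y 0 i)) ->
  bounded_measurable (fun y => k (y 0 i)) ->
  (forall t, h t + h (- t) = 2 * k t) ->
  E (fun y => h (y 0 i)) = E (fun y => k (y 0 i)).
Proof.
move=> bh bh' bk hk.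
have : E (fun y => h (y 0 i)) + E (fun y => h (- y 0 i)) =
    2 * E (fun y => k (y 0 i)).
  by rewrite -(meanD sigmaP)// -(meanZ sigmaP)//; apply: eq_mean => y _.
rewrite -(mean_entry_opp sigmaP ij bh); lra.
Qed.

Definition zsign s t : R := if s < t then 1 else -1.

Lemma bounded_measurable_zsign s : bounded_measurable (fun y => zsign s (y 0 i)).
Proof.
have -> : (fun y => zsign s (y 0 i)) =
   (fun y => 2 * \1_[set y : borel_rV R n | s < (y : 'rV[R]_n) 0 i] y - 1).
  apply/funext => y; rewrite /zsign indicE; case: ifPn => ys.
    by rewrite mem_set//= mulr1; lra.
  by rewrite memNset/= ?mulr0 ?sub0r//; exact/negP.
apply: bounded_measurableD; last exact: bounded_measurable_cst.
apply: bounded_measurableM; first exact: bounded_measurable_cst.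
apply: bounded_measurable_indic; apply: measurable_open_rV.
rewrite (_ : [set _ | _] = (fun y : 'rV[R]_n => y 0 i) @^-1` [set r | s < r])//.
by apply: open_comp => [y _|]; [exact: continuous_entry|exact: open_gt].
Qed.

Lemma bounded_measurable_zsignN s : bounded_measurable (fun y => zsign s (- y 0 i)).
Proof.
have -> : (fun y => zsign s (- y 0 i)) =
   (fun y => 2 * \1_[set y : borel_rV R n | (y : 'rV[R]_n) 0 i < - s] y - 1).
  apply/funext => y; rewrite /zsign indicE ltrNr; case: ifPn => ys.
    by rewrite mem_set//= mulr1; lra.
  by rewrite memNset/= ?mulr0 ?sub0r//; exact/negP.
apply: bounded_measurableD; last exact: bounded_measurable_cst.
apply: bounded_measurableM; first exact: bounded_measurable_cst.
apply: bounded_measurable_indic; apply: measurable_open_rV.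
rewrite (_ : [set _ | _] = (fun y : 'rV[R]_n => y 0 i) @^-1` [set r | r < - s])//.
by apply: open_comp => [y _|]; [exact: continuous_entry|exact: open_lt].
Qed.

Lemma mean_zsign s : 0 < s ->
  E (fun y => zsign s (y 0 i)) = - E (zone i s).
Proof.
move=> s0; have bi := bounded_measurable_zone i s.
transitivity (E (fun y => - 1 * zone i s y)); last first.
  by rewrite (meanZ sigmaP)// mulN1r.
apply: (mean_entry_sym (h := zsign s) (k := fun t => - 1 * (`|t| <= s)%R%:R)).
- exact: bounded_measurable_zsign.
- exact: bounded_measurable_zsignN.
- by apply: bounded_measurableM => //; exact: bounded_measurable_cst.
move=> t; rewrite /zsign ler_norml lerNl.
have [st|ts] := ltP s t; have [st'|ts'] := ltP s (- t); rewrite /=; lra.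
Qed.

Lemma mean_entry_zsign s : 0 < s ->
  E (fun y => y 0 i * zsign s (y 0 i)) =
  E (fun y => `|y 0 i|) - E (fun y => `|y 0 i| * zone i s y).
Proof.
move=> s0; have bi := bounded_measurable_zone i s.
have ba := @bounded_measurable_abs_entry R n i.
have be : bounded_measurable (fun y : 'rV[R]_n => y 0 i).
  by apply: (@bounded_measurable_entry R n i id) => t _; exact: cvg_id.
rewrite -(meanB sigmaP)//; last exact: bounded_measurableM.
apply: (mean_entry_sym (h := fun t => t * zsign s t)
  (k := fun t => `|t| - `|t| * (`|t| <= s)%R%:R)).
- apply: bounded_measurableM => //; exact: bounded_measurable_zsign.
- apply: bounded_measurableM; last exact: bounded_measurable_zsignN.
  exact: bounded_measurableN.
- apply: bounded_measurableD => //; apply: bounded_measurableN.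
  exact: bounded_measurableM.
move=> t; rewrite /zsign ler_norml lerNl.
have [st|ts] := ltP s t; have [st'|ts'] := ltP s (- t); rewrite /=; try lra.
- by rewrite gtr0_norm; lra.
- by rewrite ltr0_norm; lra.
Qed.

(** [|y_i| <= s] almost everywhere would force [E |y_i| <= s]. *)
Lemma zone_mass_lt1 s :
  s < E (fun y => `|y 0 i|) -> 0 <= s ->
  0 <= E (zone i s) < 1.
Proof.
move=> sM s0; have bi := bounded_measurable_zone i s.
have ba := @bounded_measurable_abs_entry R n i.
apply/andP; split.
  by rewrite -(mean_cst sigmaP 0); apply: (le_mean sigmaP) => //; exact: bounded_measurable_cst.
have b : bounded_measurable (fun y : 'rV[R]_n => s * 1 + (1 - zone i s y)).
  apply: bounded_measurableD; first exact: bounded_measurable_cst.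
  by apply: bounded_measurableD; [exact: bounded_measurable_cst|exact: bounded_measurableN].
have : E (fun y => `|y 0 i|) <= E (fun y => s * 1 + (1 - zone i s y)).
  apply: (le_mean sigmaP) => // y /(@entry_itv _ _ i); rewrite -ler_norml => y1.
  rewrite /zone; by have [ys|ys] := leP `|y 0 i| s; rewrite /=; lra.
rewrite (meanD sigmaP); last 2 first.
- exact: bounded_measurable_cst.
- by apply: bounded_measurableD; [exact: bounded_measurable_cst|exact: bounded_measurableN].
rewrite (meanB sigmaP)//; last exact: bounded_measurable_cst.
rewrite !(mean_cst sigmaP); lra.
Qed.

Lemma zone_moment_le s : 0 <= s ->
  E (fun y => `|y 0 i| * zone i s y) <= s.
Proof.
move=> s0; rewrite -[leRHS](mean_cst sigmaP); apply: (le_mean sigmaP).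
- apply: bounded_measurableM; first exact: bounded_measurable_abs_entry.
  exact: bounded_measurable_zone.
- exact: bounded_measurable_cst.
- by move=> y _; rewrite /zone; have [ys|ys] := leP `|y 0 i| s; rewrite /= ?mulr1 ?mulr0.
Qed.

(** [1 - f] and [1 + f] are nonnegative with positive mean, and the Poisson
    kernel is positive with mean [1]. *)
Lemma poisson_integral_lt1 (f : 'rV[R]_n -> R) (x : 'rV[R]_n) :
  (3 <= n)%N -> bounded_measurable f -> (forall y, S y -> `|f y| <= 1) ->
  `|E f| < 1 -> uball x -> `|E (fun y => poisson x y * f y)| < 1.
Proof.
move=> n3 bf f1 Ef bx.
have tot := poisson_total sigmaP bx n3.
have bP : bounded_measurable (poisson x).
  apply: bounded_measurable_continuous => y Sy.
  exact: continuous_slice (cont_poisson bx Sy).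
have bPf : bounded_measurable (fun y => poisson x y * f y) by exact: bounded_measurableM.
have b1 : bounded_measurable (fun _ : 'rV[R]_n => 1 : R) by exact: bounded_measurable_cst.
have P0 y : S y -> 0 < poisson x y by exact: poisson_gt0.
rewrite ltr_norml; apply/andP; split.
- have : 0 < E (fun y => poisson x y * (1 + f y)).
    apply: (mean_gt0 sigmaP) => //; first exact: bounded_measurableD.
      by move=> y /f1; rewrite ler_norml => /andP[h _]; lra.
    rewrite (meanD sigmaP)// (mean_cst sigmaP).
    by move: Ef; rewrite ltr_norml => /andP[h _]; lra.
  have -> : E (fun y => poisson x y * (1 + f y)) =
      1 + E (fun y => poisson x y * f y).
    by rewrite -[X in X + _]tot -(meanD sigmaP)//; apply: eq_mean => y _; ring.
  lra.
- have : 0 < E (fun y => poisson x y * (1 - f y)).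
    apply: (mean_gt0 sigmaP) => //.
    + by apply: bounded_measurableD => //; exact: bounded_measurableN.
    + by move=> y /f1; rewrite ler_norml => /andP[_ h]; lra.
    rewrite (meanB sigmaP)// (mean_cst sigmaP).
    by move: Ef; rewrite ltr_norml => /andP[_ h]; lra.
  have -> : E (fun y => poisson x y * (1 - f y)) =
      1 - E (fun y => poisson x y * f y).
    by rewrite -[X in X - _]tot -(meanB sigmaP)//; apply: eq_mean => y _; ring.
  lra.
Qed.

Lemma ler_enorm_entry (x : 'rV[R]_n) (k : 'I_n) : `|x 0 k| <= enorm x.
Proof.
rewrite -(@ler_pXn2r _ 2)// ?nnegrE ?enorm_ge0//.
rewrite sqr_enorm -normrX ger0_norm ?sqr_ge0// /dotv (bigD1 k)//= -expr2 lerDl.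
by apply: sumr_ge0 => l _; rewrite -expr2 sqr_ge0.
Qed.

End ZonalSign.

(** Multiply by [n w] and use that [8 (n - 1)] is at most
    [4 (n - 1) n w M]. *)
Lemma kappa_lt {R : realType} (n w M : R) :
  1 < n -> 0 < w -> n ^+ 2 * w ^+ 2 < 8 * (n - 1) -> 2 <= n * w * M ->
  n * w < 4 * ((n - 1) * M).
Proof.
move=> n1 w0 nw Mge.
have nw0 : 0 < n * w by rewrite mulr_gt0// (lt_trans ltr01).
rewrite -(ltr_pM2l nw0).
have -> : n * w * (n * w) = n ^+ 2 * w ^+ 2 by ring.
apply: lt_le_trans nw _.
have -> : n * w * (4 * ((n - 1) * M)) = 4 * (n - 1) * (n * w * M) by ring.
have n10 : 0 <= 4 * (n - 1) by rewrite mulr_ge0// subr_ge0 ltW.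
have := ler_wpM2l n10 Mge; lra.
Qed.

(** Put [kap = n w / 2].  As [n M >= 2 / w], it is enough that
    [kap X < D^2].  By the bound on [X] the difference is at least
    [D^2 - kap s D + kap s^2 m'], a quadratic polynomial in [D] whose discriminant
    is negative when [kap < 4 m']. *)
Lemma gradient_inequality {R : realType} (n w M D X s : R) :
  1 < n -> 0 < w -> n ^+ 2 * w ^+ 2 < 8 * (n - 1) -> 2 <= n * w * M ->
  0 < s -> s <= (M - n * w / (4 * (n - 1))) / 2 -> X <= s ->
  X <= s * D - (n - 1) * s ^+ 2 / 2 * (M - X) ->
  2 * w^-1 * (1 - D ^+ 2) < n * (M - X).
Proof.
move=> n1 w0 nw Mge s0 sM Xs XD.
have n10 : 0 < n - 1 by rewrite subr_gt0.
pose kap := n * w / 2; pose m' := (n - 1) / 2 * (M - s).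
have kap0 : 0 < kap by rewrite divr_gt0 ?mulr_gt0// (lt_trans ltr01).
have kapM : 1 <= kap * M by rewrite /kap; lra.
have kapm : kap < 4 * m'.
  have kM := kappa_lt n1 w0 nw Mge.
  have : (n - 1) * s <= (n - 1) * ((M - n * w / (4 * (n - 1))) / 2).
    by rewrite ler_pM2l.
  have -> : (n - 1) * ((M - n * w / (4 * (n - 1))) / 2) = ((n - 1) * M - kap / 2) / 2.
    by rewrite /kap; field; rewrite gt_eqF.
  by rewrite /m' /kap; lra.
have X1 : X <= s * D - s ^+ 2 * m'.
  apply: le_trans XD _; rewrite lerD2l lerN2 /m'.
  have : 0 <= (n - 1) * s ^+ 2 / 2 * (s - X).
    by rewrite mulr_ge0 ?subr_ge0// divr_ge0// mulr_ge0 ?sqr_ge0// ltW.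
  lra.
have DX : kap * X < D ^+ 2.
  have h1 : kap * X <= kap * (s * D - s ^+ 2 * m') by rewrite ler_pM2l.
  apply: le_lt_trans h1 _.
  have : 0 < kap * s ^+ 2 * (4 * m' - kap).
    by rewrite mulr_gt0 ?subr_gt0// mulr_gt0// exprn_gt0.
  have := sqr_ge0 (2 * D - kap * s).
  rewrite !expr2; lra.
rewrite mulrAC ltr_pdivrMr//.
have e : n * (M - X) * w = 2 * (kap * M - kap * X) by rewrite /kap; field.
rewrite e; lra.
Qed.

Theorem theorem2p1 (R : realType) (n : nat) (n_ge4 : (4 <= n)%N)
    (sigma0 : {measure set (borel_rV R n) -> \bar R})
    (sigma0P : normalized_sphere_measure sigma0) :
  exists gamma : R, 0 < gamma < pi /\
    let u := h0 sigma0 gamma in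
    [/\ harmonic_on (@uball R n) u,
        (forall x : 'rV[R]_n, uball x -> -1 < u x < 1) &
        exists x : 'rV[R]_n, uball x /\
          enorm (grad u x) >
            2 * (omega n.-1 / omega n) *
            ((1 - u x ^+ 2) / (1 - enorm x ^+ 2))].
Proof.
have [p np] : exists p, n = p.+4 by exists (n - 4)%N; rewrite -addn4 subnK.
have n0 : (n.-1 < n)%N by rewrite np.
have n0' : (0 < n)%N by rewrite np.
pose i : 'I_n := Ordinal n0; pose j : 'I_n := Ordinal n0'.
have ij : i != j by rewrite -val_eqE /= np.
have northE y : dotv (north n) y = y 0 i :> R.
  rewrite -dotv_delta dotvC; congr dotv; apply/rowP => k.
  rewrite !mxE -val_eqE /=; congr (nat_of_bool _)%:R.
  apply/eqP/eqP => [/(congr1 predn) kn|->]; last exact: prednK.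
  exact/val_inj.
pose E (g : 'rV[R]_n -> R) : R :=
  Rintegral sigma0 (@usphere R n : set (borel_rV R n)) g.
pose M := E (fun y => `|y 0 i|).
pose w : R := wallis n.-1; have w0 : 0 < w := wallis_gt0 _.
have wn : n%:R ^+ 2 * w ^+ 2 < 8 * (n%:R - 1).
  have -> : n%:R - 1 = p.+3%:R :> R by rewrite np -[p.+4]addn1 natrD addrK.
  by rewrite /w np; exact: wallis_lt.
have wM : 2 <= n%:R * w * M.
  have nm : n = p.+1.+3 by [].
  have := abs_moment_ge sigma0P i nm; rewrite -/(E _) -/M -wallisSS /w np /=.
  lra.
have n1 : 1 < n%:R :> R by rewrite ltr1n np.
(* The first bound keeps the angle acos s inside (0, pi) and is at most 1 as
   zone_mass_ge asks; the second one is the bound of gradient_inequality. *)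
pose s : R := Num.min (1 / 2) ((M - n%:R * w / (4 * (n%:R - 1))) / 2).
have sM : s <= (M - n%:R * w / (4 * (n%:R - 1))) / 2 by rewrite ge_min lexx orbT.
have s12 : s <= 1 / 2 by rewrite ge_min lexx.
have k0 : 0 < n%:R * w / (4 * (n%:R - 1)).
  by rewrite divr_gt0 ?mulr_gt0// ?subr_gt0// (lt_trans ltr01).
have s0 : 0 < s.
  rewrite lt_min divr_gt0//= divr_gt0// subr_gt0 ltr_pdivrMr ?mulr_gt0 ?subr_gt0//.
  have -> : M * (4 * (n%:R - 1)) = 4 * ((n%:R - 1) * M) by ring.
  exact: kappa_lt.
have M0 : s < M by lra.
exists (acos s); split.
  by rewrite acos_gt0 ?acos_ltpi//; apply/andP; split; lra.
have capE : cap (acos s) = [set y : 'rV[R]_n | usphere y /\ s < y 0 i].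
  apply/seteqP; split => y; rewrite /cap /= northE acosK//;
  by rewrite in_itv/=; apply/andP; split; lra.
pose f (y : 'rV[R]_n) : R := zsign s (y 0 i).
have bf : bounded_measurable f by exact: bounded_measurable_zsign.
have fE y : usphere y ->
    \1_(cap (acos s)) y - \1_(@usphere R n `\` cap (acos s)) y = f y.
  move=> Sy; rewrite capE !indicE /f /zsign; case: ifPn => sy.
    by rewrite mem_set// memNset ?subr0// => -[_]; apply.
  have nsy : ~ (usphere y /\ s < y 0 i) by case=> _; exact/negP.
  by rewrite memNset// mem_set ?sub0r.
have uE : h0 sigma0 (acos s) = (fun z => E (fun y => poisson z y * f y)).
  apply/funext => z; apply: eq_Rintegral => y /[!inE] Sy.
  by rewrite fE.
set D := E (zone i s).
set X := E (fun y => `|y 0 i| * zone i s y).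
have ED : E f = - D := mean_zsign sigma0P ij s0.
have D01 : 0 <= D < 1 by exact: (zone_mass_lt1 sigma0P M0 (ltW s0)).
have b0 : uball (0 : 'rV[R]_n) by rewrite /uball /= enorm0.
have dist0 k y : usphere y -> distN k (0 : 'rV[R]_n) y = 1.
  by move=> /usphereP y1; rewrite /distN sub0r /enorm dotvNl dotvNr opprK y1 sqrtr1 expr1n invr1.
rewrite uE; split.
- exact: harmonic_poisson_integral.
- move=> x bx; rewrite -ltr_norml; apply: (poisson_integral_lt1 sigma0P) => //.
  + by rewrite np.
  + by move=> y _; rewrite /f /zsign; case: ifP; rewrite ?normrN normr1.
  + by rewrite -/(E f) ED normrN; case/andP: D01 => h ?; rewrite ger0_norm.
exists 0; split => //.
have u0 : E (fun y => poisson 0 y * f y) = - D.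
  rewrite -ED; apply: eq_mean => y Sy.
  by rewrite /poisson enorm0 dist0// expr0n subr0 !mul1r.
have g0 : partial i (fun z => E (fun y => poisson z y * f y)) 0 = n%:R * (M - X).
  have [_ gE] := is_derive_poisson_integral sigma0P bf i b0.
  rewrite [LHS]gE.
  rewrite -(mean_entry_zsign sigma0P ij s0) -(meanZ sigma0P); last first.
    apply: bounded_measurableM => //.
    by apply: (@bounded_measurable_entry R n i id) => t _; exact: cvg_id.
  apply: eq_mean => y Sy; rewrite /poisson1 !dist0// enorm0 !mxE expr0n /= /f.
  by ring.
rewrite u0 enorm0 sqrrN expr0n /= subr0 divr1.
have -> : omega n.-1 / omega n = w^-1 :> R.
  by rewrite /w np /= omega_ratio.
apply: lt_le_trans (ler_enorm_entry _ i).
rewrite mxE g0; apply: lt_le_trans (ler_norm _).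
apply: (gradient_inequality n1 w0 wn wM s0 sM).
  exact: (zone_moment_le sigma0P _ (ltW s0)).
apply: (zone_mass_ge sigma0P); rewrite s0/=; lra.
Qed.
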